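(* Let $H$ be a coquasi-bialgebra, $A$ a right $H$-comodule algebra, $B=A^{coH}$, and $L=(A\otimes A^{op})^{coH}$, the space of coinvariants of $A\otimes A^{op}$ for the codiagonal coaction $\rho(a\otimes b)=a_0\otimes b_0\otimes a_1b_1$. Then $L$ is an associative $B\otimes B^{op}$-algebra with unit $1_A\otimes1_A$ and multiplication $$(a\otimes b)(c\otimes d)=a_0c_0\otimes d_0b_0\,\omega^{-1}(a_1,c_1,d_1b_1)\,\omega(c_2,d_2,b_2)$$ for $a\otimes b,\ c\otimes d\in L$ (summations suppressed; products $a_0c_0$ and $d_0b_0$ are taken in $A$).
   Context: Everything is over a field $k$; $\otimes=\otimes_k$. Sweedler notation: $\Delta(h)=h_1\otimes h_2$ (summation suppressed); for a right comodule, $\rho(m)=m_0\otimes m_1$, iterated as $m_0\otimes m_1\otimes m_2$, etc. A coquasi-bialgebra is a coassociative counital coalgebra $(H,\Delta,\varepsilon)$ with coalgebra morphisms $H\otimes H\to H$, $h\otimes g\mapsto hg$, and $k\to H$, $1\mapsto 1_H$, and a convolution invertible $\omega\in(H\otimes H\otimes H)^*$ such that for all $h,g,x,y\in H$: $h_1(g_1x_1)\omega(h_2,g_2,x_2)=\omega(h_1,g_1,x_1)(h_2g_2)x_2$; $1_Hh=h1_H=h$; $\omega(h_1,g_1,x_1y_1)\omega(h_2g_2,x_2,y_2)=\omega(g_1,x_1,y_1)\omega(h_1,g_2x_2,y_2)\omega(h_2,g_3,x_3)$; $\omega(h,1_H,g)=\varepsilon(h)\varepsilon(g)$. A right $H$-comodule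 algebra is a right $H$-comodule $A$ with a multiplication and an element $1_A$ such that $\rho(ab)=a_0b_0\otimes a_1b_1$, $\rho(1_A)=1_A\otimes 1_H$, $1_Aa=a=a1_A$, $(ab)c=a_0(b_0c_0)\omega(a_1,b_1,c_1)$. $B=A^{coH}=\{a\in A:\rho(a)=a\otimes 1_H\}$ is an associative unital algebra. For a right comodule $M$, $M^{coH}=\{m:\rho(m)=m\otimes1_H\}$. $A^{op}$ has the same underlying comodule as $A$. Elements of $L$ are finite sums $\sum a\otimes b\in A\otimes A$ with $\sum a_0\otimes b_0\otimes a_1b_1=\sum a\otimes b\otimes1_H$, written $a\otimes b$. A $B\otimes B^{op}$-algebra is an algebra $L$ together with a unital $k$-algebra map $B\otimes B^{op}\to L$; here it is the one determined by $b\mapsto b\otimes1_A$ ($b\in B$) and $b\mapsto1_A\otimes b$ ($b\in B^{op}$). *)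

(* Defs.v *)
From HB Require Import structures.
From mathcomp Require Import all_boot all_order all_algebra generic_quotient.
From mathcomp Require Import boolp.

Set Implicit Arguments.
Unset Strict Implicit.
Unset Printing Implicit Defensive.

Import GRing.Theory.

Local Open Scope ring_scope.
Local Open Scope quotient_scope.

Definition bilin (k : fieldType) (U V W : lmodType k) (f : U -> V -> W) : Prop :=
  (forall u, linear (f u)) /\ (forall v, linear (f^~ v)).

(* The tensor product of two (possibly infinite-dimensional) vector spaces:
   finite formal sums of pairs modulo the congruence generated by commutativity
   and the bilinearity relations; scalars act on the first component.  Classical
   logic (boolp) is used only to decide this congruence. *)
Inductive tens_rel (k : fieldType) (U V : lmodType k) :
    seq (U * V) -> seq (U * V) -> Prop :=
| TRrefl s : tens_rel s s
| TRsym s t : tens_rel s t -> tens_rel t s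
| TRtrans s t r : tens_rel s t -> tens_rel t r -> tens_rel s r
| TRcat s s' t t' :
    tens_rel s t -> tens_rel s' t' -> tens_rel (s ++ s') (t ++ t')
| TRcatC s t : tens_rel (s ++ t) (t ++ s)
| TRDl u u' v : tens_rel [:: (u + u', v)] [:: (u, v); (u', v)]
| TRDr u v v' : tens_rel [:: (u, v + v')] [:: (u, v); (u, v')]
| TRZ a u v : tens_rel [:: (a *: u, v)] [:: (u, a *: v)]
| TR0 v : tens_rel [:: (0, v)] [::].

Section Tensor.
Context (k : fieldType) (U V : lmodType k).
Implicit Types (s t : seq (U * V)).

Definition tens_eq : rel (seq (U * V)) := fun s t => `[< tens_rel s t >].

Lemma tens_eq_refl : reflexive tens_eq.
Proof. by move=> s; apply/asboolP; apply: TRrefl. Qed.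

Lemma tens_eq_sym : symmetric tens_eq.
Proof. by move=> s t; apply/asboolP/asboolP; apply: TRsym. Qed.

Lemma tens_eq_trans : transitive tens_eq.
Proof.
by move=> t s r /asboolP st /asboolP tr; apply/asboolP; apply: TRtrans st tr.
Qed.

Canonical tens_equiv := EquivRel tens_eq tens_eq_refl tens_eq_sym tens_eq_trans.

Definition tensor := {eq_quot tens_equiv}.
HB.instance Definition _ := Choice.on tensor.
HB.instance Definition _ := EqQuotient.on tensor.

Definition tens_pi s : tensor := \pi_tensor s.

Lemma tens_piP s t : tens_pi s = tens_pi t <-> tens_rel s t.
Proof. by split=> [/eqmodP/asboolP|st] //; apply/eqmodP/asboolP. Qed.

Lemma tens_piK (x : tensor) : tens_pi (repr x) = x.
Proof. exact: reprK. Qed.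

Lemma repr_pi s : tens_rel (repr (tens_pi s)) s.
Proof. by apply/tens_piP; rewrite tens_piK. Qed.

Definition pure (u : U) (v : V) : tensor := tens_pi [:: (u, v)].

Definition tens_zero : tensor := tens_pi [::].
Definition tens_add (x y : tensor) : tensor := tens_pi (repr x ++ repr y).
Definition tens_scale (a : k) (x : tensor) : tensor :=
  tens_pi [seq (a *: p.1, p.2) | p <- repr x].
Definition tens_opp (x : tensor) : tensor := tens_scale (-1) x.

Lemma tens_rel_scale a s t : tens_rel s t ->
  tens_rel [seq (a *: p.1, p.2) | p <- s] [seq (a *: p.1, p.2) | p <- t].
Proof.
elim=> {s t} [s|s t _ IH|s t r _ IH1 _ IH2|s s' t t' _ IH1 _ IH2|s t|u u' v|u v v'|b u v|v] /=.
- exact: TRrefl.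
- exact: TRsym.
- exact: TRtrans IH1 IH2.
- by rewrite !map_cat; apply: TRcat.
- by rewrite !map_cat; apply: TRcatC.
- by rewrite scalerDr; apply: TRDl.
- exact: TRDr.
- by rewrite scalerA mulrC -scalerA; apply: TRZ.
- by rewrite scaler0; apply: TR0.
Qed.

Lemma tens_add_pi s t : tens_add (tens_pi s) (tens_pi t) = tens_pi (s ++ t).
Proof. by apply/tens_piP/TRcat; apply: repr_pi. Qed.

Lemma tens_scale_pi a s :
  tens_scale a (tens_pi s) = tens_pi [seq (a *: p.1, p.2) | p <- s].
Proof. by apply/tens_piP/tens_rel_scale; apply: repr_pi. Qed.

Lemma tens_indP (P : tensor -> Prop) : (forall s, P (tens_pi s)) -> forall x, P x.
Proof. by move=> Ps x; rewrite -(tens_piK x). Qed.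

Lemma tens_addA : associative tens_add.
Proof.
elim/tens_indP=> s; elim/tens_indP=> t; elim/tens_indP=> r.
by rewrite !tens_add_pi catA.
Qed.

Lemma tens_addC : commutative tens_add.
Proof.
elim/tens_indP=> s; elim/tens_indP=> t; rewrite !tens_add_pi.
by apply/tens_piP; apply: TRcatC.
Qed.

Lemma tens_add0 : left_id tens_zero tens_add.
Proof. by elim/tens_indP=> s; rewrite tens_add_pi. Qed.

Lemma tens_scaleDr a : {morph tens_scale a : x y / tens_add x y}.
Proof.
elim/tens_indP=> s; elim/tens_indP=> t.
by rewrite tens_add_pi !tens_scale_pi tens_add_pi map_cat.
Qed.

Lemma tens_scaleDl x :
  {morph tens_scale^~ x : a b / a + b >-> tens_add a b}.
Proof.
elim/tens_indP: x => s a b; rewrite !tens_scale_pi tens_add_pi; apply/tens_piP.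
elim: s => [|[u v] s IH] /=; first exact: TRrefl.
rewrite (scalerDl u a b).
apply: TRtrans (TRcat (TRDl _ _ _) IH) _ => /=.
rewrite -[X in tens_rel X]cat1s -[X in tens_rel _ X]cat1s.
apply: TRcat; first exact: TRrefl.
rewrite -cat_rcons -cats1.
exact: TRcat (TRcatC [:: _] _) (TRrefl _).
Qed.

Lemma tens_scaleA a b x : tens_scale a (tens_scale b x) = tens_scale (a * b) x.
Proof.
elim/tens_indP: x => s; rewrite !tens_scale_pi -map_comp; congr tens_pi.
by apply: eq_map => p /=; rewrite scalerA.
Qed.

Lemma tens_scale1 : left_id 1 tens_scale.
Proof.
elim/tens_indP=> s; rewrite tens_scale_pi; congr tens_pi.
by rewrite -[RHS]map_id; apply: eq_map => -[u v] /=; rewrite scale1r.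
Qed.

Lemma tens_scale0 x : tens_scale 0 x = tens_zero.
Proof.
elim/tens_indP: x => s; rewrite tens_scale_pi; apply/tens_piP.
elim: s => [|[u v] s IH] /=; first exact: TRrefl.
rewrite scale0r -cat1s -[X in tens_rel _ X]cats0.
exact: TRcat (TR0 _ _) IH.
Qed.

Lemma tens_addN : left_inverse tens_zero tens_opp tens_add.
Proof.
move=> x; rewrite /tens_opp -{2}[x]tens_scale1 -tens_scaleDl addNr.
exact: tens_scale0.
Qed.

HB.instance Definition _ :=
  GRing.isZmodule.Build tensor tens_addA tens_addC tens_add0 tens_addN.

HB.instance Definition _ :=
  GRing.Zmodule_isLmodule.Build k tensor
    tens_scaleA tens_scale1 tens_scaleDr tens_scaleDl.

End Tensor.

Notation "U \ox V" := (tensor U V) (at level 40, left associativity) : type_scope.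
Notation "u \ot v" := (pure u v) (at level 40, left associativity) : ring_scope.

(* [tsum f x] sums f over the pairs of a chosen representative of x.  It is only
   ever used with f bilinear; it is then independent of the representative and
   is the linear extension of u (x) v |-> f u v (tsum_pure, tsum_linear). *)
Definition tsum (k : fieldType) (U V : lmodType k) (W : nmodType)
  (f : U -> V -> W) (x : U \ox V) : W := \sum_(p <- repr x) f p.1 p.2.

(* Sweedler notation: \swd_(u, v <- x) E is E summed over x = \sum u \ot v.
   Iterated coproducts are nested, e.g. h1 (x) h2 (x) h3 is
   (h1, h' <- Delta h) followed by (h2, h3 <- Delta h'). *)
Notation "\swd_ ( u , v <- x ) E" := (tsum (fun u v => E) x)
  (at level 41, E at level 41, u name, v name,
   format "'[' \swd_ ( u ,  v  <-  x ) '/  '  E ']'") : ring_scope.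

Section TensorTheory.
Context (k : fieldType) (U V : lmodType k).

Lemma pureDl u u' (v : V) : (u + u' : U) \ot v = u \ot v + u' \ot v.
Proof. by rewrite [RHS]tens_add_pi; apply/tens_piP; apply: TRDl. Qed.

Lemma pureDr (u : U) v v' : u \ot (v + v' : V) = u \ot v + u \ot v'.
Proof. by rewrite [RHS]tens_add_pi; apply/tens_piP; apply: TRDr. Qed.

Lemma pureZl a (u : U) (v : V) : (a *: u) \ot v = a *: (u \ot v).
Proof. by rewrite [RHS]tens_scale_pi. Qed.

Lemma pureZr a (u : U) (v : V) : u \ot (a *: v) = a *: (u \ot v).
Proof.
by rewrite [RHS]tens_scale_pi; apply/tens_piP; apply: TRsym; apply: TRZ.
Qed.

Lemma pure_bilin : bilin (@pure k U V).
Proof.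
by split=> [u|v] a x y /=; rewrite ?pureDr ?pureZr ?pureDl ?pureZl.
Qed.

Lemma tens_sum (x : U \ox V) : x = \swd_(u, v <- x) u \ot v.
Proof.
rewrite -{1}(tens_piK x) /tsum; elim: (repr x) => [|[u v] s IH].
  by rewrite big_nil.
by rewrite big_cons -IH [RHS]tens_add_pi.
Qed.

Lemma tens_ind (P : U \ox V -> Prop) :
  P 0 -> (forall u v, P (u \ot v)) -> (forall x y, P x -> P y -> P (x + y)) ->
  forall x, P x.
Proof. by move=> P0 Pp PD x; rewrite (tens_sum x); apply: big_ind. Qed.

Section Lift.
Context (W : lmodType k) (f : U -> V -> W) (fB : bilin f).

Lemma bilinDl u u' v : f (u + u') v = f u v + f u' v.
Proof. by have := fB.2 v 1 u u'; rewrite !scale1r. Qed.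
Lemma bilinDr u v v' : f u (v + v') = f u v + f u v'.
Proof. by have := fB.1 u 1 v v'; rewrite !scale1r. Qed.
Lemma bilin0l v : f 0 v = 0.
Proof. by apply: (addIr (f 0 v)); rewrite -bilinDl !add0r. Qed.
Lemma bilin0r u : f u 0 = 0.
Proof. by apply: (addIr (f u 0)); rewrite -bilinDr !add0r. Qed.
Lemma bilinZl a u v : f (a *: u) v = a *: f u v.
Proof. by have := fB.2 v a u 0; rewrite !addr0 bilin0l addr0. Qed.
Lemma bilinZr a u v : f u (a *: v) = a *: f u v.
Proof. by have := fB.1 u a v 0; rewrite !addr0 bilin0r addr0. Qed.

Lemma tens_rel_sum s t : tens_rel s t ->
  \sum_(p <- s) f p.1 p.2 = \sum_(p <- t) f p.1 p.2.
Proof.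
elim=> {s t} [//|s t _ -> //|s t r _ -> _ -> //|s s' t t' _ IH1 _ IH2|s t|u u' v|u v v'|b u v|v].
- by rewrite !big_cat IH1 IH2.
- by rewrite !big_cat /= addrC.
- by rewrite !big_cons !big_nil !addr0 bilinDl.
- by rewrite !big_cons !big_nil !addr0 bilinDr.
- by rewrite !big_cons !big_nil !addr0 bilinZl bilinZr.
- by rewrite !big_cons !big_nil bilin0l addr0.
Qed.

Lemma tsum_pi s : tsum f (tens_pi s) = \sum_(p <- s) f p.1 p.2.
Proof. exact/tens_rel_sum/repr_pi. Qed.

Lemma tsum_pure u v : tsum f (u \ot v) = f u v.
Proof. by rewrite tsum_pi big_cons big_nil addr0. Qed.

Lemma tsum_linear : linear (tsum f).
Proof.
move=> a; elim/tens_indP=> s; elim/tens_indP=> t.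
rewrite [a *: _]tens_scale_pi [_ + _ in LHS]tens_add_pi !tsum_pi big_cat big_map.
by rewrite scaler_sumr; congr (_ + _); apply: eq_bigr => p _; rewrite bilinZl.
Qed.

End Lift.

Lemma eq_tsum (W : nmodType) (f g : U -> V -> W) (x : U \ox V) :
  (forall u v, f u v = g u v) -> tsum f x = tsum g x.
Proof. by move=> fg; apply: eq_bigr => p _. Qed.

Lemma tens_lin_eq (W : lmodType k) (f g : U \ox V -> W) :
  linear f -> linear g -> (forall u v, f (u \ot v) = g (u \ot v)) -> f =1 g.
Proof.
move=> fL gL fg; have D (h : U \ox V -> W) :
    linear h -> {morph h : x y / x + y}.
  by move=> hL x y; have := hL 1 x y; rewrite !scale1r.
have Z (h : U \ox V -> W) : linear h -> h 0 = 0.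
  by move=> hL; apply: (addIr (h 0)); rewrite -(D h hL) !add0r.
elim/tens_ind=> [|//|x y IHx IHy]; first by rewrite !Z.
by rewrite !D // IHx IHy.
Qed.

Lemma linear_tsum (W X : lmodType k) (f : U -> V -> X -> W) (x : U \ox V) :
  (forall u v, linear (f u v)) -> linear (fun y => \swd_(u, v <- x) f u v y).
Proof.
move=> fL a y z; rewrite /tsum scaler_sumr -big_split /=.
by apply: eq_bigr => p _; apply: fL.
Qed.

End TensorTheory.

Lemma bilin_comp (k : fieldType) (U V W X : lmodType k)
    (f : U -> V -> W) (g : W -> X) :
  bilin f -> linear g -> bilin (fun u v => g (f u v)).
Proof. by move=> [fr fl] gL; split=> [u|v] a x y; rewrite ?fr ?fl gL. Qed.

Lemma bilin_tsum (k : fieldType) (U V W X Y : lmodType k)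
    (f : U -> V -> W -> X -> Y) :
  (forall v w x, linear (fun u => f u v w x)) ->
  (forall u w x, linear (fun v => f u v w x)) ->
  (forall u v, bilin (f u v)) ->
  bilin (fun (u : U \ox V) (w : W \ox X) =>
    \swd_(u1, v1 <- u) \swd_(w1, x1 <- w) f u1 v1 w1 x1).
Proof.
move=> f1 f2 f3; split=> [u|w].
  by apply: linear_tsum => u1 v1; apply: tsum_linear.
apply: tsum_linear; split=> [u1|v1] a y z; rewrite /tsum scaler_sumr -big_split.
  by apply: eq_bigr => p _; apply: f2.
by apply: eq_bigr => p _; apply: f1.
Qed.

Lemma tsum2_pure (k : fieldType) (U V W X Y : lmodType k)
    (f : U -> V -> W -> X -> Y) u v w x :
  (forall v w x, linear (fun u => f u v w x)) ->
  (forall u w x, linear (fun v => f u v w x)) ->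
  (forall u v, bilin (f u v)) ->
  \swd_(u1, v1 <- u \ot v) \swd_(w1, x1 <- w \ot x) f u1 v1 w1 x1 = f u v w x.
Proof.
move=> f1 f2 f3; rewrite (eq_tsum _ (fun u v => tsum_pure (f3 u v) w x)).
by rewrite (tsum_pure (f := fun u v => f u v w x)) //; split=> ?.
Qed.

(* Associative unital k-algebra structure on a vector space.  MathComp's algType
   requires 1 != 0; here the zero algebra must be allowed, since a comodule
   algebra may be 0. *)
Definition assoc_algebra (k : fieldType) (V : lmodType k)
    (mul : V -> V -> V) (one : V) : Prop :=
  [/\ bilin mul, associative mul, left_id one mul & right_id one mul].

Definition algebra_map (k : fieldType) (V W : lmodType k)
    (mulV : V -> V -> V) (oneV : V) (mulW : W -> W -> W) (oneW : W)
    (phi : V -> W) : Prop :=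
  [/\ linear phi, {morph phi : x y / mulV x y >-> mulW x y} & phi oneV = oneW].

(* Multiplication of V (x) W^op. *)
Definition tens_op_mul (k : fieldType) (V W : lmodType k)
    (mulV : V -> V -> V) (mulW : W -> W -> W) (x y : V \ox W) : V \ox W :=
  \swd_(v, w <- x) \swd_(v', w' <- y) mulV v v' \ot mulW w' w.

Lemma tens_op_mul_bilin (k : fieldType) (V W : lmodType k)
    (mulV : V -> V -> V) (mulW : W -> W -> W) :
  bilin mulV -> bilin mulW -> bilin (tens_op_mul mulV mulW).
Proof.
move=> bV bW; apply: bilin_tsum => [v w x|u w x|u v].
- by move=> a y z; rewrite (bV.2 w) pureDl pureZl.
- by move=> a y z; rewrite (bW.1 x) pureDr pureZr.
- split=> [w|x] a y z; first by rewrite (bW.2 v) pureDr pureZr.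
  by rewrite (bV.1 u) pureDl pureZl.
Qed.

Lemma tens_op_mul_pure (k : fieldType) (V W : lmodType k)
    (mulV : V -> V -> V) (mulW : W -> W -> W) v w v' w' :
  bilin mulV -> bilin mulW ->
  tens_op_mul mulV mulW (v \ot w) (v' \ot w') = mulV v v' \ot mulW w' w.
Proof.
move=> bV bW; apply: tsum2_pure => [v1 w1 x|u w1 x|u v1].
- by move=> a y z; rewrite (bV.2 w1) pureDl pureZl.
- by move=> a y z; rewrite (bW.1 x) pureDr pureZr.
- split=> [w1|x] a y z; first by rewrite (bW.2 v1) pureDr pureZr.
  by rewrite (bV.1 u) pureDl pureZl.
Qed.

Lemma tens_op_mul_algebra (k : fieldType) (V W : lmodType k)
    (mulV : V -> V -> V) (oneV : V) (mulW : W -> W -> W) (oneW : W) :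
  assoc_algebra mulV oneV -> assoc_algebra mulW oneW ->
  assoc_algebra (tens_op_mul mulV mulW) (oneV \ot oneW).
Proof.
move=> [bV aV lV rV] [bW aW lW rW].
have B := tens_op_mul_bilin bV bW; have E := tens_op_mul_pure _ _ _ _ bV bW.
split=> // [x y z|x|x].
- elim/tens_ind: x => [|u v|x x' IHx IHx']; rewrite ?(bilinDl B) ?(bilin0l B) ?IHx ?IHx' //.
  elim/tens_ind: y => [|u' v'|y y' IHy IHy'].
  + by rewrite !(bilin0l B, bilin0r B).
  + elim/tens_ind: z => [|u2 v2|z z' IHz IHz'].
    * by rewrite !(bilin0l B, bilin0r B).
    * by rewrite !E aV aW.
    * by rewrite !(bilinDr B) IHz IHz'.
  + by rewrite (bilinDl B) !(bilinDr B) (bilinDl B) IHy IHy'.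
- elim/tens_ind: x => [|u v|x y IHx IHy]; first exact: bilin0r.
    by rewrite E lV rW.
  by rewrite (bilinDr B) IHx IHy.
- elim/tens_ind: x => [|u v|x y IHx IHy]; first exact: bilin0l.
    by rewrite E rV lW.
  by rewrite (bilinDl B) IHx IHy.
Qed.

Record coalgebra (k : fieldType) := Coalgebra {
  coalg_sort :> lmodType k;
  comul : {linear coalg_sort -> coalg_sort \ox coalg_sort};
  counit : {scalar coalg_sort};
  comulA : forall h,
    \swd_(h1, h2 <- comul h) \swd_(h11, h12 <- comul h1) (h11 \ot h12) \ot h2 =
    \swd_(h1, h2 <- comul h) \swd_(h21, h22 <- comul h2) (h1 \ot h21) \ot h22;
  counit_comul : forall h, \swd_(h1, h2 <- comul h) (counit h1 *: h2) = h;
  comul_counit : forall h, \swd_(h1, h2 <- comul h) (counit h2 *: h1) = h }.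

Record coquasi_data (k : fieldType) := CoquasiData {
  cqd_coalg :> coalgebra k;
  cqd_mul : {linear cqd_coalg \ox cqd_coalg -> cqd_coalg};
  cqd_one : cqd_coalg;
  cqd_omega : {scalar (cqd_coalg \ox cqd_coalg) \ox cqd_coalg};
  cqd_omegaV : {scalar (cqd_coalg \ox cqd_coalg) \ox cqd_coalg} }.

Definition Hmul (k : fieldType) (H : coquasi_data k) (h g : H) : H :=
  cqd_mul H (h \ot g).
Definition omega (k : fieldType) (H : coquasi_data k) (h g x : H) : k :=
  cqd_omega H ((h \ot g) \ot x).
Definition omegaV (k : fieldType) (H : coquasi_data k) (h g x : H) : k :=
  cqd_omegaV H ((h \ot g) \ot x).

Notation "h *h g" := (Hmul h g) (at level 40, left associativity) : ring_scope.
Notation "1h" := (cqd_one _) : ring_scope.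

(* omegaV is the convolution inverse of omega, which is unique. *)
Record coquasi_bialgebra (k : fieldType) := CoquasiBialgebra {
  cqb_data :> coquasi_data k;
  comul_mul : forall h g : cqb_data, comul cqb_data (h *h g) =
    \swd_(h1, h2 <- comul cqb_data h) \swd_(g1, g2 <- comul cqb_data g)
      (h1 *h g1) \ot (h2 *h g2);
  counit_mul : forall h g : cqb_data,
    counit cqb_data (h *h g) = counit cqb_data h * counit cqb_data g;
  comul_one : comul cqb_data 1h = 1h \ot 1h;
  counit_one : counit cqb_data 1h = 1;
  omegaK : forall h g x : cqb_data,
    \swd_(h1, h2 <- comul cqb_data h) \swd_(g1, g2 <- comul cqb_data g)
    \swd_(x1, x2 <- comul cqb_data x)
      (omega h1 g1 x1 * omegaV h2 g2 x2) =
    counit cqb_data h * counit cqb_data g * counit cqb_data x;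
  omegaVK : forall h g x : cqb_data,
    \swd_(h1, h2 <- comul cqb_data h) \swd_(g1, g2 <- comul cqb_data g)
    \swd_(x1, x2 <- comul cqb_data x)
      (omegaV h1 g1 x1 * omega h2 g2 x2) =
    counit cqb_data h * counit cqb_data g * counit cqb_data x;
  Hmul_quasiA : forall h g x : cqb_data,
    \swd_(h1, h2 <- comul cqb_data h) \swd_(g1, g2 <- comul cqb_data g)
    \swd_(x1, x2 <- comul cqb_data x)
      (omega h2 g2 x2 *: (h1 *h (g1 *h x1))) =
    \swd_(h1, h2 <- comul cqb_data h) \swd_(g1, g2 <- comul cqb_data g)
    \swd_(x1, x2 <- comul cqb_data x)
      (omega h1 g1 x1 *: ((h2 *h g2) *h x2));
  Hmul1 : forall h : cqb_data, 1h *h h = h;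
  Hmulr1 : forall h : cqb_data, h *h 1h = h;
  omega_cocycle : forall h g x y : cqb_data,
    \swd_(h1, h2 <- comul cqb_data h) \swd_(g1, g2 <- comul cqb_data g)
    \swd_(x1, x2 <- comul cqb_data x) \swd_(y1, y2 <- comul cqb_data y)
      (omega h1 g1 (x1 *h y1) * omega (h2 *h g2) x2 y2) =
    \swd_(h1, h2 <- comul cqb_data h)
    \swd_(g1, g' <- comul cqb_data g) \swd_(g2, g3 <- comul cqb_data g')
    \swd_(x1, x' <- comul cqb_data x) \swd_(x2, x3 <- comul cqb_data x')
    \swd_(y1, y2 <- comul cqb_data y)
      (omega g1 x1 y1 * omega h1 (g2 *h x2) y2 * omega h2 g3 x3);
  omega_unit : forall h g : cqb_data,
    omega h 1h g = counit cqb_data h * counit cqb_data g }.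

Record comodule (k : fieldType) (H : coalgebra k) := Comodule {
  comod_sort :> lmodType k;
  coact : {linear comod_sort -> comod_sort \ox H};
  coactA : forall m,
    \swd_(m0, m1 <- coact m) \swd_(m00, m01 <- coact m0) (m00 \ot m01) \ot m1 =
    \swd_(m0, m1 <- coact m) \swd_(m11, m12 <- comul H m1) (m0 \ot m11) \ot m12;
  coact_counit : forall m, \swd_(m0, m1 <- coact m) (counit H m1 *: m0) = m }.

Record comodule_algebra (k : fieldType) (H : coquasi_bialgebra k) :=
  ComoduleAlgebra {
  ca_comod :> comodule H;
  ca_mul : {linear ca_comod \ox ca_comod -> ca_comod};
  ca_one : ca_comod;
  coact_mul : forall a b : ca_comod, coact ca_comod (ca_mul (a \ot b)) =
    \swd_(a0, a1 <- coact ca_comod a) \swd_(b0, b1 <- coact ca_comod b)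
      ca_mul (a0 \ot b0) \ot ((a1 : H) *h b1);
  coact_one : coact ca_comod ca_one = ca_one \ot (1h : H);
  ca_mul1 : forall a, ca_mul (ca_one \ot a) = a;
  ca_mulr1 : forall a, ca_mul (a \ot ca_one) = a;
  ca_mul_quasiA : forall a b c : ca_comod,
    ca_mul (ca_mul (a \ot b) \ot c) =
    \swd_(a0, a1 <- coact ca_comod a) \swd_(b0, b1 <- coact ca_comod b)
    \swd_(c0, c1 <- coact ca_comod c)
      (omega (a1 : H) b1 c1 *: ca_mul (a0 \ot ca_mul (b0 \ot c0))) }.

Definition Amul (k : fieldType) (H : coquasi_bialgebra k)
  (A : comodule_algebra H) (a b : A) : A := ca_mul A (a \ot b).

Notation "a *a b" := (Amul a b) (at level 40, left associativity) : ring_scope.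
Notation "1a" := (ca_one _) : ring_scope.

Section Coinvariants.
Context (k : fieldType) (H : coquasi_bialgebra k) (M : lmodType k).
Context (rho : {linear M -> M \ox H}).

Definition coinvariant : {pred M} := [pred m | rho m == m \ot (1h : H)].

Lemma coinvariant_submod : submod_closed coinvariant.
Proof.
split=> [|a m n]; rewrite !inE.
  by rewrite linear0 (bilin0l (@pure_bilin _ _ _)).
by move=> /eqP rm /eqP rn; rewrite linearP rm rn pureDl pureZl.
Qed.

HB.instance Definition _ :=
  GRing.isSubmodClosed.Build k M coinvariant coinvariant_submod.

Record coinv := Coinv { coinv_val : M; _ : coinv_val \in coinvariant }.

HB.instance Definition _ := [isSub for coinv_val].
HB.instance Definition _ := [Choice of coinv by <:].
HB.instance Definition _ := [SubChoice_isSubLmodule of coinv by <:].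

Lemma coinvP (x : coinv) : rho (val x) = val x \ot (1h : H).
Proof. by apply/eqP; apply: (valP x). Qed.

End Coinvariants.

Section Codiagonal.
Context (k : fieldType) (H : coquasi_bialgebra k) (M N : comodule H).

Definition codiag (x : M \ox N) : (M \ox N) \ox H :=
  \swd_(m, n <- x) \swd_(m0, m1 <- coact M m) \swd_(n0, n1 <- coact N n)
    (m0 \ot n0) \ot ((m1 : H) *h n1).

Lemma Hmul_bilin : bilin (@Hmul k H).
Proof. exact: bilin_comp (@pure_bilin _ _ _) (@linearP _ _ _ _ _). Qed.

Lemma codiag_linear : linear codiag.
Proof.
apply: tsum_linear.
have B : bilin (fun (x : M \ox H) (y : N \ox H) =>
    \swd_(m0, m1 <- x) \swd_(n0, n1 <- y) (m0 \ot n0) \ot ((m1 : H) *h n1)).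
  have [HR HL] := Hmul_bilin.
  apply: bilin_tsum => [v w x|u w x|u v].
  - by move=> a y z; rewrite pureDl pureZl pureDl pureZl.
  - by move=> a y z; rewrite HL pureDr pureZr.
  - split=> [w|x] a y z; first by rewrite HR pureDr pureZr.
    by rewrite pureDr pureZr pureDl pureZl.
by split=> [m|n] a x y; rewrite linearP ?(B.1 (coact M m)) ?(B.2 (coact N n)).
Qed.

HB.instance Definition _ :=
  GRing.isLinear.Build k (M \ox N) ((M \ox N) \ox H) _ codiag codiag_linear.

End Codiagonal.

Arguments codiag {k H} M N x.

Notation coinvB A := (coinv (coact A)).

(* The coaction of A (x) A^op: A^op is A as a comodule. *)
Notation coinvL A := (coinv (codiag A A)).

Section CoinvariantAlgebra.
Context (k : fieldType) (H : coquasi_bialgebra k) (A : comodule_algebra H).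

Lemma Amul_bilin : bilin (@Amul k H A).
Proof. exact: bilin_comp (@pure_bilin _ _ _) (@linearP _ _ _ _ _). Qed.

Lemma coact_Amul (a b : A) : coact A (a *a b) =
  \swd_(a0, a1 <- coact A a) \swd_(b0, b1 <- coact A b)
    (a0 *a b0) \ot ((a1 : H) *h b1).
Proof. exact: coact_mul. Qed.

Lemma Amul_quasiA (a b c : A) : (a *a b) *a c =
  \swd_(a0, a1 <- coact A a) \swd_(b0, b1 <- coact A b) \swd_(c0, c1 <- coact A c)
    (omega (a1 : H) b1 c1 *: (a0 *a (b0 *a c0))).
Proof. exact: ca_mul_quasiA. Qed.

Lemma coinvB_mul (a b : A) : a \in coinvariant (coact A) ->
  b \in coinvariant (coact A) -> a *a b \in coinvariant (coact A).
Proof.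
rewrite !inE => /eqP ra /eqP rb; rewrite coact_Amul ra rb.
have [HR HL] := Hmul_bilin H; have [AR AL] := Amul_bilin.
rewrite tsum2_pure ?Hmul1 //.
- by move=> v w x c y z; rewrite AL pureDl pureZl.
- by move=> u w x c y z; rewrite HL pureDr pureZr.
- move=> u v; split=> [w|x] c y z; first by rewrite HR pureDr pureZr.
  by rewrite AR pureDl pureZl.
Qed.

Lemma coinvB_one : (1a : A) \in coinvariant (coact A).
Proof. by rewrite inE coact_one. Qed.

Definition mulB (a b : coinvB A) : coinvB A :=
  Coinv (coinvB_mul (valP a) (valP b)).
Definition oneB : coinvB A := Coinv coinvB_one.

Lemma coinvB_algebra : assoc_algebra mulB oneB.
Proof.
have [AR AL] := Amul_bilin.
have wB : bilin (fun (u : A) (v : H) => u \ot v) by exact: pure_bilin.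
split=> [|a b c|a|a]; last 2 first.
- by apply: val_inj; rewrite /= /Amul ca_mul1.
- by apply: val_inj; rewrite /= /Amul ca_mulr1.
- split=> [a|a] x b c; apply: val_inj; rewrite ?linearP /=.
    exact: AR.
  exact: AL.
apply: val_inj => /=; rewrite [RHS]Amul_quasiA (coinvP a) (coinvP b) (coinvP c).
have wl v w : linear (fun x : H => omega x v w : k^o).
  by move=> x y z; rewrite /omega pureDl pureZl pureDl pureZl linearP.
have wm v w : linear (fun x : H => omega v x w : k^o).
  by move=> x y z; rewrite /omega pureDr pureZr pureDl pureZl linearP.
have wr v w : linear (fun x : H => omega v w x : k^o).
  by move=> x y z; rewrite /omega pureDr pureZr linearP.
under eq_tsum => u v.
  under eq_tsum => u' v'.
    rewrite tsum_pure; last first.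
      split=> [x|x] e y z.
        by rewrite wr scalerDl -scalerA.
      by rewrite AR AR scalerDr !scalerA mulrC.
    over.
  over.
rewrite tsum2_pure.
- by rewrite omega_unit counit_one mulr1 scale1r.
- by move=> v w x e y z; rewrite AL scalerDr !scalerA mulrC.
- by move=> u w x e y z; rewrite wl scalerDl -scalerA.
- move=> u v; split=> [w|x] e y z.
    by rewrite wm scalerDl -scalerA.
  by rewrite AL AR scalerDr !scalerA mulrC.
Qed.

(* (a (x) b)(c (x) d) = a0 c0 (x) d0 b0 omega^-1(a1, c1, d1 b1) omega(c2, d2, b2),
   extended bilinearly to A (x) A. *)
Definition mulAA (x y : A \ox A) : A \ox A :=
  \swd_(a, b <- x) \swd_(c, d <- y)
  \swd_(a0, a1 <- coact A a)
  \swd_(b0, b' <- coact A b) \swd_(b1, b2 <- comul H b')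
  \swd_(c0, c' <- coact A c) \swd_(c1, c2 <- comul H c')
  \swd_(d0, d' <- coact A d) \swd_(d1, d2 <- comul H d')
    ((omegaV (a1 : H) c1 (d1 *h b1) * omega c2 d2 b2) *: ((a0 *a c0) \ot (d0 *a b0))).

End CoinvariantAlgebra.

Arguments mulB {k H A} a b.
Arguments oneB {k H} A.

(* Main.v *)
(* In the monoidal category of right H-comodules, with associator Phi given by
   omega, A is an algebra, and A (x) A is an A-bimodule under the left action
   lact = (m (x) A) Phi^-1 and the right action ract = (A (x) m) Phi.  It is free
   on 1 (x) 1, so each coinvariant z determines the colinear bimodule
   endomorphism ins z = lact (A (x) ract (z (x) -)) with ins z (1 (x) 1) = z, and
   the product of x and y is ins y x.  Its coinvariance is then colinearity of
   ins y, and associativity is ins z (ins y x) = ins (ins z y) x, which holds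
   because ins z commutes with both actions.  The bimodule axioms come from the
   pentagon for Phi, that is, from the cocycle condition on omega.  Of the unit
   conditions on omega only the middle one is an axiom; omega (1, g, h) and
   omega (g, h, 1) are trivial because, by the cocycle condition, they are
   idempotent and invertible for convolution. *)

Require Import Defs.
From HB Require Import structures.
From mathcomp Require Import all_boot all_order all_algebra.

Set Implicit Arguments.
Unset Strict Implicit.
Unset Printing Implicit Defensive.

Import GRing.Theory.
Local Open Scope ring_scope.

(** * Tensor products of linear maps *)

Section LinearTerms.
Context (k : fieldType).
Implicit Types U V W X Y : lmodType k.

Lemma linear_idf U : linear (fun x : U => x).
Proof. by []. Qed.

Lemma linear_scale U V (f : U -> V) c x : linear f -> f (c *: x) = c *: f x.
Proof.
move=> fL; pose l : {linear U -> V} := HB.pack f (GRing.isLinear.Build _ _ _ _ f fL).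
exact: (linearZ_LR l).
Qed.

Lemma linear_compf X U V (g : U -> V) (f : X -> U) :
  linear g -> linear f -> linear (fun x => g (f x)).
Proof. by move=> gL fL a x y; rewrite fL gL. Qed.

Lemma linear_purel X U V (f : X -> U) (v : V) :
  linear f -> linear (fun x => f x \ot v).
Proof. by move=> fL a x y; rewrite fL pureDl pureZl. Qed.

Lemma linear_purer X U V (u : U) (f : X -> V) :
  linear f -> linear (fun x => u \ot f x).
Proof. by move=> fL a x y; rewrite fL pureDr pureZr. Qed.

Lemma linear_scalel X V (f : X -> k^o) (v : V) :
  linear f -> linear (fun x => (f x : k) *: v).
Proof. by move=> fL a x y; rewrite fL scalerDl scalerA. Qed.

Lemma linear_scaler X V (c : k) (f : X -> V) :
  linear f -> linear (fun x => c *: f x).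
Proof. by move=> fL a x y; rewrite fL scalerDr !scalerA mulrC. Qed.

Lemma linear_tsum_arg X U V W (F : U -> V -> W) (f : X -> U \ox V) :
  bilin F -> linear f -> linear (fun x => tsum F (f x)).
Proof. by move=> FB fL a x y; rewrite fL tsum_linear. Qed.

Lemma linear_tsum_body X U V W (F : X -> U -> V -> W) (t : U \ox V) :
  (forall u v, linear (fun x => F x u v)) -> linear (fun x => tsum (F x) t).
Proof. by move=> FL; apply: (linear_tsum (f := fun u v x => F x u v)). Qed.

Lemma tsum_lin U V W X (g : {linear W -> X}) (F : U -> V -> W) (x : U \ox V) :
  g (tsum F x) = \swd_(u, v <- x) g (F u v).
Proof. exact: linear_sum. Qed.

Lemma tsum_map U V W X (g : W -> X) (F : U -> V -> W) (x : U \ox V) :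
  linear g -> g (tsum F x) = \swd_(u, v <- x) g (F u v).
Proof.
move=> gL; pose l : {linear W -> X} := HB.pack g (GRing.isLinear.Build _ _ _ _ g gL).
exact: (tsum_lin l).
Qed.

Lemma tsum_scaler U V W (c : k) (F : U -> V -> W) (x : U \ox V) :
  c *: tsum F x = \swd_(u, v <- x) c *: F u v.
Proof. exact: scaler_sumr. Qed.

Lemma tsumZ U V W (F : U -> V -> W) c x : bilin F -> tsum F (c *: x) = c *: tsum F x.
Proof.
move=> FB; rewrite -[c *: x]addr0 (tsum_linear FB).
by rewrite [tsum F 0](tsum_pi FB) big_nil addr0.
Qed.

Lemma tsum_tsum (U V W X Y : lmodType k) (F : W -> X -> Y) (G : U -> V -> W \ox X)
  (x : U \ox V) :
  bilin F -> tsum F (tsum G x) = \swd_(u, v <- x) tsum F (G u v).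
Proof. by move=> FB; apply: (tsum_map (g := tsum F)); apply: tsum_linear. Qed.

Lemma tsumC (U V W X : lmodType k) (Y : nmodType) (F : U -> V -> W -> X -> Y)
  (x : U \ox V) (y : W \ox X) :
  \swd_(u, v <- x) \swd_(w, z <- y) F u v w z =
  \swd_(w, z <- y) \swd_(u, v <- x) F u v w z.
Proof. exact: exchange_big. Qed.

End LinearTerms.

(* Proves linearity of terms in which the bound variable occurs once. *)
Ltac multilinear :=
  intros; cbv beta;
  lazymatch goal with
  | |- bilin _ => split; multilinear
  | |- linear (fun x => x) => apply: linear_idf
  | |- linear (fun x => pure (@?f x) (@?g x)) =>
      first [refine (linear_purel (f := f) _ _) | refine (linear_purer (f := g) _ _)];
      multilinear
  | |- linear (fun x => GRing.scale (@?f x) (@?g x)) =>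
      first [refine (linear_scaler (f := g) _ _) | refine (linear_scalel (f := f) _ _)];
      multilinear
  | |- linear (fun x => tsum (@?F x) (@?f x)) =>
      first [ refine (linear_tsum_body (F := F) _ _)
            | refine (linear_tsum_arg (f := f) _ _) ]; multilinear
  | |- _ => first
      [ assumption
      | match goal with
        | |- linear (fun x => ?g (@?f x)) =>
            first [ refine (linear_compf (g := g) (f := f) (@linearP _ _ _ _ _) _)
                  | refine (linear_compf (g := g) (f := f) _ _); [solve [auto] |] ];
            solve [multilinear]
        | |- linear (fun x => ?g (@?f x) ?c) =>
            refine (linear_compf (g := fun y => g y c) (f := f) _ _);
            [solve [auto] | solve [multilinear]]
        | |- linear (fun x => ?g (@?f x) ?c ?d) =>
            refine (linear_compf (g := fun y => g y c d) (f := f) _ _);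
            [solve [auto] | solve [multilinear]]
        end ]
  end.

(* Linear maps on a tensor product agree once they agree on pure tensors; both linearity conditions
   are left to [multilinear], so the tensor should occur once on each side. *)
Tactic Notation "tens_ext" ident(x) ident(u) ident(v) :=
  revert x;
  lazymatch goal with |- forall x, @?f x = @?g x =>
    refine (tens_lin_eq (f := f) (g := g) _ _ _); [solve [multilinear]|solve [multilinear]|]
  end; intros u v; cbv beta.

(** * Functoriality and associativity of the tensor product *)

Section TensorMaps.
Context (k : fieldType).
Implicit Types U V W X Y : lmodType k.

Definition tmap U V W X (f : {linear U -> W}) (g : {linear V -> X})
  (x : U \ox V) : W \ox X := \swd_(u, v <- x) f u \ot g v.

Lemma tmap_linear U V W X (f : {linear U -> W}) (g : {linear V -> X}) :
  linear (tmap f g).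
Proof. by apply: tsum_linear; multilinear. Qed.

HB.instance Definition _ U V W X (f : {linear U -> W}) (g : {linear V -> X}) :=
  GRing.isLinear.Build k (U \ox V) (W \ox X) _ (tmap f g) (tmap_linear f g).

Lemma tmapE U V W X (f : {linear U -> W}) (g : {linear V -> X}) u v :
  tmap f g (u \ot v) = f u \ot g v.
Proof. by rewrite /tmap tsum_pure //; multilinear. Qed.

Definition tassoc U V W (x : (U \ox V) \ox W) : U \ox (V \ox W) :=
  \swd_(uv, w <- x) \swd_(u, v <- uv) u \ot (v \ot w).

Lemma tassoc_linear U V W : linear (@tassoc U V W).
Proof. by apply: tsum_linear; multilinear. Qed.

HB.instance Definition _ U V W :=
  GRing.isLinear.Build k _ _ _ (@tassoc U V W) (@tassoc_linear U V W).

Lemma tassocE U V W (u : U) (v : V) (w : W) :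
  tassoc ((u \ot v) \ot w) = u \ot (v \ot w).
Proof. by rewrite /tassoc !tsum_pure //; multilinear. Qed.

Definition tassocV U V W (x : U \ox (V \ox W)) : (U \ox V) \ox W :=
  \swd_(u, vw <- x) \swd_(v, w <- vw) (u \ot v) \ot w.

Lemma tassocV_linear U V W : linear (@tassocV U V W).
Proof. by apply: tsum_linear; multilinear. Qed.

HB.instance Definition _ U V W :=
  GRing.isLinear.Build k _ _ _ (@tassocV U V W) (@tassocV_linear U V W).

Lemma tassocVE U V W (u : U) (v : V) (w : W) :
  tassocV (u \ot (v \ot w)) = (u \ot v) \ot w.
Proof. by rewrite /tassocV !tsum_pure //; multilinear. Qed.

Lemma tassocK U V W : cancel (@tassoc U V W) (@tassocV U V W).
Proof.
move=> x; tens_ext x uv w; tens_ext uv u v; by rewrite tassocE tassocVE.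
Qed.

Lemma tassocVK U V W : cancel (@tassocV U V W) (@tassoc U V W).
Proof.
by move=> x; tens_ext x u vw; tens_ext vw v w; rewrite tassocVE tassocE.
Qed.

End TensorMaps.

(** * Coactions and convolution *)

Section Coactions.
Context (k : fieldType).
Implicit Types (U V W X Y Z C D E : lmodType k).

(** With [r := d] this is coassociativity of [d] itself; in general it is the first axiom of a right
    comodule over [C]. *)
Definition coassoc U C (r : {linear U -> U \ox C}) (d : {linear C -> C \ox C}) :=
  forall u, \swd_(u0, u1 <- r u) \swd_(u00, u01 <- r u0) (u00 \ot u01) \ot u1 =
            \swd_(u0, u1 <- r u) \swd_(u11, u12 <- d u1) (u0 \ot u11) \ot u12.

(** Coassociativity in the form used in Sweedler calculus: the linear extension of a trilinear [F]
    is applied to both sides of the identity in the triple tensor product. *)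
Lemma coassoc_tsum U C r d Z (F : U -> C -> C -> Z) u :
  @coassoc U C r d ->
  (forall c c', linear (fun u => F u c c')) ->
  (forall u c', linear (fun c => F u c c')) ->
  (forall u c, linear (F u c)) ->
  \swd_(u0, u1 <- r u) \swd_(u00, u01 <- r u0) F u00 u01 u1 =
  \swd_(u0, u1 <- r u) \swd_(u11, u12 <- d u1) F u0 u11 u12.
Proof.
move=> /(_ u) rd F1 F2 F3.
have B c' : bilin (fun u c => F u c c') by split.
pose G (uc : U \ox C) (c' : C) := \swd_(u, c <- uc) F u c c'.
have GB : bilin G by rewrite /G; multilinear; apply: F3.
have := congr1 (tsum G) rd; rewrite !(tsum_tsum _ _ GB) => E.
etransitivity; [|etransitivity; first exact: E]; apply: eq_tsum => u0 u1;
  rewrite (tsum_tsum _ _ GB); apply: eq_tsum => v w; rewrite (tsum_pure GB) /G.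
all: by rewrite (tsum_pure (B _)).
Qed.

Definition counital U C (r : {linear U -> U \ox C}) (e : C -> k) :=
  forall u, \swd_(u0, u1 <- r u) (e u1 *: u0) = u.

(* The coaction of C (x) D on U (x) V; for r, s coproducts it is the coproduct
   of the tensor product coalgebra. *)
Definition box U V C D (r : {linear U -> U \ox C}) (s : {linear V -> V \ox D})
    (x : U \ox V) : (U \ox V) \ox (C \ox D) :=
  \swd_(u, v <- x) \swd_(u0, u1 <- r u) \swd_(v0, v1 <- s v)
    (u0 \ot v0) \ot (u1 \ot v1).

Lemma box_linear U V C D r s : linear (@box U V C D r s).
Proof. by apply: tsum_linear; multilinear. Qed.

HB.instance Definition _ U V C D r s :=
  GRing.isLinear.Build k _ _ _ (@box U V C D r s) (@box_linear U V C D r s).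

Lemma boxE U V C D r s u v : @box U V C D r s (u \ot v) =
  \swd_(u0, u1 <- r u) \swd_(v0, v1 <- s v) (u0 \ot v0) \ot (u1 \ot v1).
Proof. by rewrite /box tsum_pure //; multilinear. Qed.

Lemma box_tsum U V C D r s Z (F : U \ox V -> C \ox D -> Z) u v : bilin F ->
  tsum F (@box U V C D r s (u \ot v)) =
  \swd_(u0, u1 <- r u) \swd_(v0, v1 <- s v) F (u0 \ot v0) (u1 \ot v1).
Proof.
move=> FB; rewrite boxE tsum_tsum //; apply: eq_tsum => u0 u1.
rewrite tsum_tsum //; apply: eq_tsum => v0 v1; exact: tsum_pure.
Qed.

Lemma box_coassoc U V C D r s d d' :
  coassoc r d -> coassoc s d' -> coassoc (@box U V C D r s) (box d d').
Proof.
move=> rd sd x; tens_ext x u v.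
rewrite !box_tsum; [|by multilinear..].
under eq_tsum => u0 u1 do under eq_tsum => v0 v1 do (rewrite box_tsum; last by multilinear).
under [RHS]eq_tsum => u0 u1 do under eq_tsum => v0 v1 do
  (rewrite box_tsum; last by multilinear).
(* The sums are interchanged so that the two coassociativities can be applied one factor at a
   time. *)
under eq_tsum => u0 u1 do rewrite tsumC.
rewrite (coassoc_tsum (F := fun u00 u01 u1 => \swd_(v0, v1 <- s v)
  \swd_(v00, v01 <- s v0)
  ((u00 \ot v00) \ot (u01 \ot v01)) \ot (u1 \ot v1)) _ rd); [|by multilinear..].
apply: eq_tsum => u0 u1; rewrite [RHS]tsumC; apply: eq_tsum => u11 u12.
by rewrite (coassoc_tsum (F := fun v00 v01 v1 =>
  ((u0 \ot v00) \ot (u11 \ot v01)) \ot (u12 \ot v1)) _ sd); [|multilinear..].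
Qed.

Definition etens C D (phi : {linear C -> k^o}) (psi : {linear D -> k^o})
  (x : C \ox D) : k^o := \swd_(c, d <- x) (phi c : k) *: psi d.

Lemma etens_linear C D phi psi : linear (@etens C D phi psi).
Proof. by apply: tsum_linear; multilinear. Qed.

HB.instance Definition _ C D phi psi :=
  GRing.isLinear.Build k _ _ _ (@etens C D phi psi) (@etens_linear C D phi psi).

Lemma etensE C D (phi : {linear C -> k^o}) (psi : {linear D -> k^o}) c d :
  etens phi psi (c \ot d) = phi c * psi d.
Proof. by rewrite /etens tsum_pure //; multilinear. Qed.

(** The left action of the convolution algebra of functionals on [C] on a right [C]-comodule. [Phi]
    and [PhiV] are such actions up to rebracketing, so composing them amounts to convolving
    functionals ([act_act]). *)
Definition act U C (phi : {linear C -> k^o}) (r : {linear U -> U \ox C})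
  (u : U) : U := \swd_(u0, u1 <- r u) ((phi u1 : k) *: u0).

Lemma act_linear U C phi r : linear (@act U C phi r).
Proof. by rewrite /act; multilinear. Qed.

HB.instance Definition _ U C phi r :=
  GRing.isLinear.Build k _ _ _ (@act U C phi r) (@act_linear U C phi r).

Lemma eq_act U C (phi psi : {linear C -> k^o}) (r : {linear U -> U \ox C}) :
  phi =1 psi -> act phi r =1 act psi r.
Proof. by move=> E u; apply: eq_tsum => u0 u1; rewrite E. Qed.

Definition conv C (d : {linear C -> C \ox C}) (phi psi : {linear C -> k^o})
  (c : C) : k^o := \swd_(c1, c2 <- d c) ((phi c1 : k) *: psi c2).

Lemma conv_linear C d phi psi : linear (@conv C d phi psi).
Proof. by rewrite /conv; multilinear. Qed.

HB.instance Definition _ C d phi psi :=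
  GRing.isLinear.Build k _ _ _ (@conv C d phi psi) (@conv_linear C d phi psi).

Lemma act_act U C r d (phi psi : {linear C -> k^o}) u : @coassoc U C r d ->
  act phi r (act psi r u) = act (conv d phi psi) r u.
Proof.
move=> rd; rewrite [act psi r u]/act (tsum_lin (act phi r)).
under eq_tsum => u0 u1.
  rewrite linearZ /= [act phi r u0]/act tsum_scaler.
  over.
rewrite (coassoc_tsum (F := fun u00 u01 u1 =>
  (psi u1 : k) *: ((phi u01 : k) *: u00)) _ rd); [|multilinear..].
apply: eq_tsum => u0 u1; rewrite /conv.
rewrite (tsum_map (g := fun c : k^o => (c : k) *: u0)); last by multilinear.
by apply: eq_tsum => u11 u12; rewrite scalerA [in LHS]mulrC.
Qed.

(** Coacting after the action of [phi] leaves [phi] on the last of the three legs; in [tsum_act],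
    where the coaction comes first, [phi] lands on the middle leg. *)
Lemma tsum_coact_act U C r d (phi : {linear C -> k^o}) Z (F : U -> C -> Z) u :
  @coassoc U C r d -> bilin F ->
  tsum F (r (act phi r u)) =
  \swd_(u0, u1 <- r u) F u0 (\swd_(u11, u12 <- d u1) ((phi u12 : k) *: u11)).
Proof.
move=> rd FB; have [Fr Fl] := FB.
rewrite [act _ _ _]/act (tsum_lin r) tsum_tsum //.
transitivity (\swd_(u0, u1 <- r u) \swd_(u00, u01 <- r u0) ((phi u1 : k) *: F u00 u01)).
  apply: eq_tsum => u0 u1; rewrite linearZ /= (tsumZ _ _ FB).
  exact: tsum_scaler.
rewrite (coassoc_tsum (F := fun u00 u01 u1 => (phi u1 : k) *: F u00 u01) _ rd);
  [|multilinear..].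
apply: eq_tsum => u0 u1; rewrite (tsum_map (g := F u0)) //.
by apply: eq_tsum => u11 u12; rewrite (bilinZr FB).
Qed.

Lemma tsum_act U C r d (phi : {linear C -> k^o}) Z (F : U -> C -> Z) u :
  @coassoc U C r d -> bilin F ->
  \swd_(u0, u1 <- r u) F (act phi r u0) u1 =
  \swd_(u0, u1 <- r u) F u0 (\swd_(u11, u12 <- d u1) ((phi u11 : k) *: u12)).
Proof.
move=> rd FB; have [Fr Fl] := FB.
transitivity (\swd_(u0, u1 <- r u) \swd_(u00, u01 <- r u0) ((phi u01 : k) *: F u00 u1)).
  apply: eq_tsum => u0 u1; rewrite (tsum_map (g := F^~ u1)) //.
  by apply: eq_tsum => u00 u01; rewrite (bilinZl FB).
rewrite (coassoc_tsum (F := fun u00 u01 u1 => (phi u01 : k) *: F u00 u1) _ rd);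
  [|multilinear..].
apply: eq_tsum => u0 u1; rewrite (tsum_map (g := F u0)) //.
by apply: eq_tsum => u11 u12; rewrite (bilinZr FB).
Qed.

Lemma act_counital U C r (e : {linear C -> k^o}) u : @counital U C r e -> act e r u = u.
Proof. exact. Qed.

Lemma act_etens U V C D (phi : {linear C -> k^o}) (psi : {linear D -> k^o}) r s :
  act (etens phi psi) (@box U V C D r s) =1 tmap (act phi r) (act psi s).
Proof.
move=> x; tens_ext x u v; rewrite tmapE /act box_tsum; last by multilinear.
rewrite (tsum_map (g := fun u => u \ot _)); last by multilinear.
apply: eq_tsum => u0 u1; rewrite (tsum_map (g := fun v => _ \ot v)); last by multilinear.
by apply: eq_tsum => v0 v1; rewrite /= etensE pureZr pureZl scalerA mulrC.
Qed.

(** A comodule morphism over a map of coefficient spaces: [g := idfun] gives colinear maps,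
    [f := idfun] a change of coefficients. *)
Definition comor U V C D (f : U -> V) (g : C -> D) (r : {linear U -> U \ox C})
    (s : {linear V -> V \ox D}) :=
  forall u, s (f u) = \swd_(u0, u1 <- r u) f u0 \ot g u1.

Lemma comor_tsum U V C D (f : {linear U -> V}) (g : {linear C -> D}) r s
    Z (F : V -> D -> Z) u :
  @comor U V C D f g r s -> bilin F ->
  tsum F (s (f u)) = \swd_(u0, u1 <- r u) F (f u0) (g u1).
Proof.
by move=> c FB; rewrite c tsum_tsum //; apply: eq_tsum => a b; rewrite tsum_pure.
Qed.

Lemma comor_idf U C r : @comor U U C C idfun idfun r r.
Proof. by move=> u; rewrite -tens_sum. Qed.

(** Moves an action past a morphism at the price of pulling the functional back along [g]. This is
    how actions of functionals on different tensor powers of [H] are brought to a common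
    coalgebra. *)
Lemma act_comor U V C D (f : {linear U -> V}) (g : {linear C -> D}) r s
    (phi : {linear D -> k^o}) u :
  @comor U V C D f g r s -> act phi s (f u) = f (act (phi \o g) r u).
Proof.
move=> c; rewrite /act (comor_tsum _ c); last by multilinear.
rewrite (tsum_lin f); apply: eq_tsum => u0 u1.
by rewrite linearZ.
Qed.

Lemma comor_comp U V W C D E (f : {linear U -> V}) (g : {linear C -> D})
    (f' : {linear V -> W}) (g' : {linear D -> E}) r s t :
  @comor U V C D f g r s -> @comor V W D E f' g' s t ->
  comor (f' \o f) (g' \o g) r t.
Proof.
by move=> c c' u; rewrite /= c' (comor_tsum _ c) //; multilinear.
Qed.

Lemma comor_box U V C D U' V' C' D' (f : {linear U -> V}) (g : {linear C -> D})
  (f' : {linear U' -> V'}) (g' : {linear C' -> D'}) r s r' s' :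
  @comor U V C D f g r s -> @comor U' V' C' D' f' g' r' s' ->
  comor (tmap f f') (tmap g g') (box r r') (box s s').
Proof.
move=> c c' x; tens_ext x u v; rewrite /= tmapE boxE box_tsum; last by multilinear.
rewrite (comor_tsum _ c); last by multilinear.
apply: eq_tsum => u0 u1; rewrite (comor_tsum _ c'); last by multilinear.
by apply: eq_tsum => v0 v1; rewrite !tmapE.
Qed.

Lemma comor_tassoc U V W C D E r s t :
  comor (@tassoc k U V W) (@tassoc k C D E) (box (box r s) t) (box r (box s t)).
Proof.
move=> x; tens_ext x uv w; tens_ext uv u v.
rewrite /= tassocE [LHS]boxE !box_tsum; [|by multilinear..].
apply: eq_tsum => u0 u1; rewrite box_tsum; last by multilinear.
by apply: eq_tsum => v0 v1; apply: eq_tsum => w0 w1; rewrite !tassocE.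
Qed.

Definition push U C D (g : {linear C -> D}) (r : {linear U -> U \ox C}) (u : U)
  : U \ox D := tmap idfun g (r u).

Lemma push_linear U C D g r : linear (@push U C D g r).
Proof. by rewrite /push; multilinear. Qed.

HB.instance Definition _ U C D g r :=
  GRing.isLinear.Build k _ _ _ (@push U C D g r) (@push_linear U C D g r).

Lemma comor_push U C D (g : {linear C -> D}) (r : {linear U -> U \ox C}) :
  @comor U U C D idfun g r (push g r).
Proof. by move=> u; rewrite /push /tmap. Qed.

Lemma push_tsum U C D g r Z (F : U -> D -> Z) u : bilin F ->
  tsum F (@push U C D g r u) = \swd_(u0, u1 <- r u) F u0 (g u1).
Proof.
by move=> FB; rewrite -(comor_tsum (f := idfun) u (comor_push g r) FB).
Qed.

Lemma push_coassoc U C D (g : {linear C -> D}) (r : {linear U -> U \ox C}) d d' :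
  coassoc r d -> comor g g d d' -> coassoc (push g r) d'.
Proof.
move=> rd gd u; rewrite !push_tsum; [|multilinear..].
under eq_tsum => u0 u1 do (rewrite push_tsum; last by multilinear).
under [RHS]eq_tsum => u0 u1 do (rewrite (comor_tsum _ gd); last by multilinear).
by rewrite (coassoc_tsum (F := fun u c c' => (u \ot g c) \ot g c') _ rd); [|multilinear..].
Qed.

Lemma push_counital U C D (g : {linear C -> D}) (r : {linear U -> U \ox C})
    (e : {linear C -> k^o}) (e' : {linear D -> k^o}) :
  counital r e -> e' \o g =1 e -> counital (push g r) e'.
Proof.
move=> re ge u; rewrite push_tsum; last by multilinear.
by rewrite -[RHS]re; apply: eq_tsum => u0 u1; rewrite -ge.
Qed.

Lemma box_counital U V C D (e : {linear C -> k^o}) (e' : {linear D -> k^o}) r s :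
  counital r e -> counital s e' -> counital (@box U V C D r s) (etens e e').
Proof.
move=> re se x; change (act (etens e e') (box r s) x = x).
rewrite act_etens; tens_ext x u v.
by rewrite tmapE; congr (_ \ot _); [apply: re | apply: se].
Qed.

End Coactions.

(** * The associator *)

Ltac tens_simp :=
  repeat first [progress simpl | rewrite tmapE | rewrite tassocE | rewrite etensE].

Section TensorMapTheory.
Context (k : fieldType).
Implicit Types (U V W X Y Z C D E : lmodType k).

Lemma tmap_comp U V W U' V' W' (f : {linear U -> V}) (g : {linear V -> W})
  (f' : {linear U' -> V'}) (g' : {linear V' -> W'}) x :
  tmap g g' (tmap f f' x) = tmap (g \o f) (g' \o f') x.
Proof. by tens_ext x u v; rewrite !tmapE. Qed.

Lemma eq_tmap U V W X (f f' : {linear U -> W}) (g g' : {linear V -> X}) :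
  f =1 f' -> g =1 g' -> tmap f g =1 tmap f' g'.
Proof. by move=> Ef Eg x; apply: eq_tsum => u v; rewrite Ef Eg. Qed.

Lemma tmap_id U V (f : {linear U -> U}) (g : {linear V -> V}) :
  f =1 id -> g =1 id -> tmap f g =1 id.
Proof. by move=> Ef Eg x; tens_ext x u v; rewrite tmapE Ef Eg. Qed.

Lemma tassoc_nat U V W U' V' W' (f : {linear U -> U'}) (g : {linear V -> V'})
  (h : {linear W -> W'}) x :
  tassoc (tmap (tmap f g) h x) = tmap f (tmap g h) (tassoc x).
Proof. by tens_ext x y w; tens_ext y u v; tens_simp. Qed.

Lemma tassoc_pentagon U V W X (x : ((U \ox V) \ox W) \ox X) :
  tassoc (tassoc x) =
  tmap (@idfun U) (@tassoc k V W X) (tassoc (tmap (@tassoc k U V W) (@idfun X) x)).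
Proof.
tens_ext x y x'; tens_ext y z w; tens_ext z u v.
by tens_simp.
Qed.

End TensorMapTheory.

Section Associator.
Context (k : fieldType) (H : coquasi_bialgebra k).
Implicit Types (U V W X Y Z : lmodType k).

Definition hmul : {linear H \ox H -> H} := cqd_mul H.
Definition eps (h : H) : k^o := counit H h.
Definition omegaf (x : (H \ox H) \ox H) : k^o := cqd_omega H x.
Definition omegaVf (x : (H \ox H) \ox H) : k^o := cqd_omegaV H x.

Lemma eps_linear : linear eps.
Proof. exact: linearP. Qed.
Lemma omegaf_linear : linear omegaf.
Proof. exact: linearP. Qed.
Lemma omegaVf_linear : linear omegaVf.
Proof. exact: linearP. Qed.
HB.instance Definition _ := GRing.isLinear.Build k _ _ _ eps eps_linear.
HB.instance Definition _ := GRing.isLinear.Build k _ _ _ omegaf omegaf_linear.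
HB.instance Definition _ := GRing.isLinear.Build k _ _ _ omegaVf omegaVf_linear.

(* The codomain k^o lets products of values be written as scalings, for which
   multilinear applies. *)
Definition om (h g x : H) : k^o := omegaf ((h \ot g) \ot x).
Definition omV (h g x : H) : k^o := omegaVf ((h \ot g) \ot x).

Local Notation d := (comul H).
Local Notation d3 := (box (box d d) d).
Local Notation eps3 := (etens (etens eps eps) eps).

Definition coaction U (r : {linear U -> U \ox H}) := coassoc r d /\ counital r eps.

Lemma comul_coassoc : coassoc d d.
Proof. exact: comulA. Qed.

Lemma comul_counital : counital d eps.
Proof. exact: comul_counit. Qed.

Lemma hmul_comor : comor hmul hmul (box d d) d.
Proof.
move=> x; tens_ext x h g; rewrite box_tsum; last by multilinear.
exact: comul_mul.
Qed.

Lemma eps_hmul : eps \o hmul =1 etens eps eps.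
Proof. by move=> x; tens_ext x h g; rewrite etensE; exact: (counit_mul (c := H) h g). Qed.

Lemma d3_tsum Z (F : (H \ox H) \ox H -> (H \ox H) \ox H -> Z) h g x : bilin F ->
  tsum F (d3 ((h \ot g) \ot x)) =
  \swd_(h1, h2 <- d h) \swd_(g1, g2 <- d g) \swd_(x1, x2 <- d x)
    F ((h1 \ot g1) \ot x1) ((h2 \ot g2) \ot x2).
Proof.
move=> FB; have [Fr Fl] := FB.
rewrite box_tsum //; rewrite box_tsum //; split; multilinear.
Qed.

Lemma conv_omegaVK : conv d3 omegaVf omegaf =1 eps3.
Proof.
move=> x; tens_ext x y z; tens_ext y h g; rewrite /conv d3_tsum; last by multilinear.
by rewrite etensE /= etensE; exact: (omegaVK h g z).
Qed.

Lemma conv_omegaK : conv d3 omegaf omegaVf =1 eps3.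
Proof.
move=> x; tens_ext x y z; tens_ext y h g; rewrite /conv d3_tsum; last by multilinear.
by rewrite etensE /= etensE; exact: (omegaK h g z).
Qed.

Definition hmul3l : {linear (H \ox H) \ox H -> H} := hmul \o tmap hmul idfun.
Definition hmul3r : {linear (H \ox H) \ox H -> H} :=
  hmul \o (tmap idfun hmul \o @tassoc k H H H).

(** Quasi-associativity of [H] as an identity over the tensor product coalgebra, with the two
    bracketings as linear maps. *)
Lemma hmul3_quasi c : \swd_(c1, c2 <- d3 c) ((omegaf c2 : k) *: hmul3r c1) =
  \swd_(c1, c2 <- d3 c) ((omegaf c1 : k) *: hmul3l c2).
Proof.
tens_ext c hg x; tens_ext hg h g; rewrite !d3_tsum; [|multilinear..].
have := Hmul_quasiA h g x.
under eq_tsum => ? ? do under eq_tsum => ? ? do under eq_tsum => ? ? do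
  rewrite /Hmul -[_ \ot cqd_mul H _](tmapE (@idfun H) hmul) -[_ \ot (_ \ot _)]tassocE.
move=> E; etransitivity; first exact: E.
apply: eq_tsum => ? ?; apply: eq_tsum => ? ?; apply: eq_tsum => ? ?.
by rewrite /Hmul -[cqd_mul H _ \ot _](tmapE hmul (@idfun H)).
Qed.

(** The codiagonal coaction, obtained from the coaction of [H \ox H] by pushing forward along the
    multiplication. Its properties thereby reduce to those of [box], in which no product of [H]
    occurs. *)
Definition tco U V (r : {linear U -> U \ox H}) (s : {linear V -> V \ox H})
  : {linear U \ox V -> (U \ox V) \ox H} := push hmul (box r s).

Lemma tcoE U V r s u v : @tco U V r s (u \ot v) =
  \swd_(u0, u1 <- r u) \swd_(v0, v1 <- s v) (u0 \ot v0) \ot hmul (u1 \ot v1).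
Proof. by rewrite /= /push /tmap box_tsum //; multilinear. Qed.

Lemma tco_coaction U V r s : coaction r -> coaction s -> coaction (@tco U V r s).
Proof.
move=> [rd re] [sd se]; split.
  exact: push_coassoc (box_coassoc rd sd) hmul_comor.
exact: push_counital (box_counital re se) eps_hmul.
Qed.

Lemma box3_coassoc U V W r s t : coaction r -> coaction s -> coaction t ->
  coassoc (@box k _ W _ _ (@box k U V _ _ r s) t) d3.
Proof. by move=> [? _] [? _] [? _]; do !apply: box_coassoc. Qed.

(** On pure tensors, u0 (x) (v0 (x) w0) omega(u1, v1, w1). The scalar part is kept apart from the
    rebracketing so that composites can be computed by convolution. *)
Definition Phi U V W (r : {linear U -> U \ox H}) (s : {linear V -> V \ox H})
    (t : {linear W -> W \ox H}) : {linear (U \ox V) \ox W -> U \ox (V \ox W)} :=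
  @tassoc k U V W \o act omegaf (box (box r s) t).

Definition PhiV U V W (r : {linear U -> U \ox H}) (s : {linear V -> V \ox H})
    (t : {linear W -> W \ox H}) : {linear U \ox (V \ox W) -> (U \ox V) \ox W} :=
  act omegaVf (box (box r s) t) \o @tassocV k U V W.

Section PhiTheory.
Context U V W (r : {linear U -> U \ox H}) (s : {linear V -> V \ox H})
  (t : {linear W -> W \ox H}).
Hypotheses (rC : coaction r) (sC : coaction s) (tC : coaction t).

Lemma act_eps3 x : act eps3 (box (box r s) t) x = x.
Proof.
apply: (box_counital (e := etens eps eps)); last exact: tC.2.
exact: box_counital rC.2 sC.2.
Qed.

(** Functionals whose convolution is the counit act as mutually inverse maps. *)
Lemma PhiK : cancel (Phi r s t) (PhiV r s t).
Proof.
move=> x; rewrite /= tassocK (act_act _ _ _ (box3_coassoc rC sC tC)).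
by rewrite (eq_act _ conv_omegaVK) act_eps3.
Qed.

Lemma PhiVK : cancel (PhiV r s t) (Phi r s t).
Proof.
move=> x; rewrite /= (act_act _ _ _ (box3_coassoc rC sC tC)).
by rewrite (eq_act _ conv_omegaK) act_eps3 tassocVK.
Qed.

Lemma comor_tco_l : comor idfun hmul3l (box (box r s) t) (tco (tco r s) t).
Proof.
move=> x; tens_ext x uv w; tens_ext uv u v; rewrite tcoE push_tsum; last by multilinear.
rewrite !box_tsum; [|multilinear..]; apply: eq_tsum => u0 u1; apply: eq_tsum => v0 v1.
by apply: eq_tsum => w0 w1; rewrite /= tmapE.
Qed.

Lemma comor_tco_r :
  comor (@tassoc k U V W) hmul3r (box (box r s) t) (tco r (tco s t)).
Proof.
move=> x; tens_ext x uv w; tens_ext uv u v; rewrite tassocE tcoE.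
rewrite !box_tsum; [|multilinear..]; apply: eq_tsum => u0 u1.
rewrite push_tsum; last by multilinear.
rewrite box_tsum; last by multilinear.
apply: eq_tsum => v0 v1; apply: eq_tsum => w0 w1.
by rewrite /= !(tassocE, tmapE).
Qed.

(** Colinearity of the associator is the quasi-associativity of [H]. *)
Lemma Phi_comor : comor (Phi r s t) idfun (tco (tco r s) t) (tco r (tco s t)).
Proof.
move=> x; have R := box3_coassoc rC sC tC.
(* Coacting after [Phi] evaluates [omegaf] on the right leg [c2], coacting before it evaluates
   [omegaf] on the left leg [c1]; [hmul3_quasi] exchanges the two. *)
have Tr : tco r (tco s t) (Phi r s t x) =
    \swd_(y0, y1 <- box (box r s) t x)
      tassoc y0 \ot (\swd_(c1, c2 <- d3 y1) ((omegaf c2 : k) *: hmul3r c1)).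
  rewrite /= comor_tco_r (tsum_coact_act _ _ R); last by multilinear.
  apply: eq_tsum => y0 y1; rewrite tsum_lin; congr (_ \ot _).
  by apply: eq_tsum => c1 c2; rewrite linearZ.
rewrite Tr (comor_tsum (f := idfun) _ comor_tco_l); last by multilinear.
rewrite [RHS](tsum_act (F := fun y c => tassoc y \ot hmul3l c) _ _ R); last by multilinear.
apply: eq_tsum => y0 y1; rewrite tsum_lin hmul3_quasi; congr (_ \ot _).
by apply: eq_tsum => c1 c2; rewrite linearZ.
Qed.

End PhiTheory.

Definition colin U V (f : U -> V) (r : {linear U -> U \ox H})
  (s : {linear V -> V \ox H}) := comor f idfun r s.

Lemma colin_tsum U V (f : {linear U -> V}) r s Z (F : V -> H -> Z) u :
  colin f r s -> bilin F ->
  tsum F (s (f u)) = \swd_(u0, u1 <- r u) F (f u0) u1.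
Proof. exact: (comor_tsum (g := idfun)). Qed.

Lemma colin_id U r : @colin U U idfun r r.
Proof. exact: comor_idf. Qed.

Lemma colin_comp U V W (f : {linear U -> V}) (g : {linear V -> W}) r s t :
  colin f r s -> colin g s t -> colin (g \o f) r t.
Proof. exact: (comor_comp (g := idfun) (g' := idfun)). Qed.

Lemma colin_tmap U V U' V' (f : {linear U -> V}) (f' : {linear U' -> V'}) r s r' s' :
  colin f r s -> colin f' r' s' -> colin (tmap f f') (tco r r') (tco s s').
Proof.
move=> c c' x; tens_ext x u v; rewrite tmapE !push_tsum; [|multilinear..].
rewrite tcoE box_tsum; last by multilinear.
rewrite (colin_tsum _ c); last by multilinear.
apply: eq_tsum => u0 u1; rewrite (colin_tsum _ c'); last by multilinear.
by apply: eq_tsum => v0 v1; rewrite tmapE.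
Qed.

Lemma Phi_colin U V W (r : {linear U -> U \ox H}) (s : {linear V -> V \ox H})
    (t : {linear W -> W \ox H}) : coaction r -> coaction s -> coaction t ->
  colin (Phi r s t) (tco (tco r s) t) (tco r (tco s t)).
Proof. exact: Phi_comor. Qed.

(** Colinear maps leave the coefficients in [H] unchanged, so the functional pulled back by
    [act_comor] is again [omegaf]. *)
Lemma Phi_nat U V W U' V' W' (f : {linear U -> U'}) (g : {linear V -> V'})
    (h : {linear W -> W'}) r s t r' s' t' x :
  colin f r r' -> colin g s s' -> colin h t t' ->
  Phi r' s' t' (tmap (tmap f g) h x) = tmap f (tmap g h) (Phi r s t x).
Proof.
move=> cf cg ch; rewrite -tassoc_nat /=; congr tassoc.
rewrite (act_comor _ _ (comor_box (comor_box cf cg) ch)).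
congr (tmap _ _ _); apply: eq_act => c /=.
by rewrite tmap_id //; apply: tmap_id.
Qed.

End Associator.

(** * The pentagon for the associator *)

Section Pentagon.
Context (k : fieldType) (H : coquasi_bialgebra k).
Context (U V W X : lmodType k).
Implicit Type Z : lmodType k.
Context (r : {linear U -> U \ox H}) (s : {linear V -> V \ox H})
  (t : {linear W -> W \ox H}) (q : {linear X -> X \ox H}).
Hypotheses (rC : coaction r) (sC : coaction s) (tC : coaction t) (qC : coaction q).

Local Notation d := (comul H).
Local Notation hmul := (hmul H).
Local Notation eps := (eps (H := H)).
Local Notation omegaf := (omegaf (H := H)).
Local Notation H4 := (((H \ox H) \ox H) \ox H).
Local Notation d4 := (box (box (box d d) d) d).
Local Notation R4 := (box (box (box r s) t) q).

(** The maps [gl], [gr], [gm] multiply the factors 1 and 2, 3 and 4, 2 and 3 respectively; [ga] only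
    rebrackets, isolating the first factor. Along them every associator of the pentagon becomes the
    action of a functional on [H4]. *)
Let gl : {linear H4 -> (H \ox H) \ox H} := tmap (tmap hmul idfun) idfun.
Let gr : {linear H4 -> (H \ox H) \ox H} :=
  tmap idfun hmul \o @tassoc k (H \ox H) H H.
Let gm : {linear H4 -> (H \ox H) \ox H} :=
  tmap (tmap idfun hmul \o @tassoc k H H H) idfun.
Let ga : {linear H4 -> H \ox ((H \ox H) \ox H)} :=
  @tassoc k H (H \ox H) H \o tmap (@tassoc k H H H) idfun.

Lemma d4_tsum Z (F : H4 -> H4 -> Z) h g x y : bilin F ->
  tsum F (d4 (((h \ot g) \ot x) \ot y)) =
  \swd_(h1, h2 <- d h) \swd_(g1, g2 <- d g) \swd_(x1, x2 <- d x) \swd_(y1, y2 <- d y)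
    F (((h1 \ot g1) \ot x1) \ot y1) (((h2 \ot g2) \ot x2) \ot y2).
Proof.
move=> FB; have [Fr Fl] := FB.
by rewrite box_tsum // d3_tsum //; split; multilinear.
Qed.

Lemma comul_counitl h : \swd_(h1, h2 <- d h) ((eps h1 : k) *: h2) = h.
Proof. exact: counit_comul. Qed.

Lemma tsum_counitl Z (F : H -> Z) h : linear F ->
  \swd_(h1, h2 <- d h) ((eps h1 : k) *: F h2) = F h.
Proof.
move=> FL; rewrite -{2}[h]comul_counitl (tsum_map _ _ FL); apply: eq_tsum => h1 h2.
by rewrite (linear_scale _ _ FL).
Qed.

Lemma tsum_counitr Z (F : H -> Z) h : linear F ->
  \swd_(h1, h2 <- d h) ((eps h2 : k) *: F h1) = F h.
Proof.
move=> FL; rewrite -{2}[h]comul_counital (tsum_map _ _ FL); apply: eq_tsum => h1 h2.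
by rewrite (linear_scale _ _ FL).
Qed.

(** The cocycle condition as an equation in the convolution algebra of functionals on [H4], each
    side listing the associators along one side of the pentagon. *)
Lemma conv_cocycle :
  conv d4 (omegaf \o gr) (omegaf \o gl) =1
  conv d4 (etens eps omegaf \o ga)
    (conv d4 (omegaf \o gm) (etens omegaf eps)).
Proof.
move=> x; tens_ext x z y; tens_ext z w x; tens_ext w h g.
transitivity (\swd_(h1, h2 <- d h) \swd_(g1, g2 <- d g)
    \swd_(x1, x2 <- d x) \swd_(y1, y2 <- d y)
      (omega h1 g1 (x1 *h y1) * omega (h2 *h g2) x2 y2)).
  rewrite /conv d4_tsum; last by multilinear.
  do 4!apply: eq_tsum => ? ?.
  by tens_simp.
rewrite omega_cocycle; symmetry.
(* The two factors containing [eps] split [h] and [y] once more than the cocycle condition does. The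
   extra leg of [y] is absorbed in proving this equality, that of [h] right after it. *)
transitivity (\swd_(h1, h2 <- d h) ((eps h1 : k) *: \swd_(g1, g2 <- d g)
    \swd_(x1, x2 <- d x) \swd_(y1, y2 <- d y) ((om g1 x1 y1 : k) *:
      \swd_(h3, h4 <- d h2) \swd_(g3, g4 <- d g2) \swd_(x3, x4 <- d x2)
        (om h3 (hmul (g3 \ot x3)) y2 : k) *: om h4 g4 x4))).
  rewrite {1}/conv d4_tsum; last by multilinear.
  apply: eq_tsum => h1 h2; rewrite tsum_scaler; apply: eq_tsum => g1 g2.
  rewrite tsum_scaler; apply: eq_tsum => x1 x2.
  rewrite tsum_scaler; apply: eq_tsum => y1 y2.
  rewrite scalerA; congr (_ *: _).
    by tens_simp.
  rewrite /= /conv. rewrite d4_tsum; last by multilinear.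
  apply: eq_tsum => h3 h4; apply: eq_tsum => g3 g4; apply: eq_tsum => x3 x4.
  rewrite -[RHS](tsum_counitr (F := fun y =>
    (om h3 (hmul (g3 \ot x3)) y : k) *: om h4 g4 x4)); last by rewrite /om; multilinear.
  apply: eq_tsum => y3 y4; tens_simp.
  by rewrite /om /GRing.scale /= mulrA mulrC.
rewrite (tsum_counitl (F := fun h2 => \swd_(g1, g2 <- d g)
    \swd_(x1, x2 <- d x) \swd_(y1, y2 <- d y) ((om g1 x1 y1 : k) *:
      \swd_(h3, h4 <- d h2) \swd_(g3, g4 <- d g2) \swd_(x3, x4 <- d x2)
        (om h3 (hmul (g3 \ot x3)) y2 : k) *: om h4 g4 x4))); last by rewrite /om; multilinear.
(* The sides now differ only in the order of independent sums and the placement of scalars. *)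
rewrite [RHS]tsumC; apply: eq_tsum => g1 g'.
under [RHS]eq_tsum => ? ? do rewrite tsumC.
rewrite [RHS]tsumC; apply: eq_tsum => x1 x'.
under [RHS]eq_tsum => ? ? do under eq_tsum => ? ? do rewrite tsumC.
under [RHS]eq_tsum => ? ? do rewrite tsumC.
rewrite [RHS]tsumC; apply: eq_tsum => y1 y2.
do 3!(rewrite tsum_scaler; apply: eq_tsum => ? ?).
by rewrite scalerA.
Qed.

Lemma comor_tco2l : comor idfun gl R4 (box (box (tco r s) t) q).
Proof.
move=> a; tens_ext a b x; tens_ext b c w; tens_ext c u v.
rewrite [LHS]boxE !box_tsum; [|multilinear..].
rewrite push_tsum; last by multilinear.
rewrite box_tsum; last by multilinear.
do 4!apply: eq_tsum => ? ?.
by tens_simp.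
Qed.

Lemma comor_tco2r :
  comor (@tassoc k (U \ox V) W X) gr R4 (box (box r s) (tco t q)).
Proof.
move=> a; tens_ext a b x; tens_ext b c w; tens_ext c u v; rewrite tassocE.
rewrite [LHS]boxE !box_tsum; [|multilinear..].
do 2!apply: eq_tsum => ? ?.
rewrite push_tsum; last by multilinear.
rewrite box_tsum; last by multilinear.
do 2!apply: eq_tsum => ? ?.
by tens_simp.
Qed.

Lemma comor_tco2m : comor (tmap (@tassoc k U V W) (@idfun X)) gm R4
  (box (box r (tco s t)) q).
Proof.
move=> a; tens_ext a b x; tens_ext b c w; tens_ext c u v; rewrite tmapE /= tassocE.
rewrite [LHS]boxE !box_tsum; [|multilinear..].
apply: eq_tsum => ? ?.
rewrite push_tsum; last by multilinear.
rewrite box_tsum; last by multilinear.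
do 3!apply: eq_tsum => ? ?.
by tens_simp.
Qed.

Lemma comor_tassoc2 :
  comor (@tassoc k U (V \ox W) X \o tmap (@tassoc k U V W) (@idfun X)) ga R4
    (box r (box (box s t) q)).
Proof.
apply: comor_comp (comor_tassoc _ _ _).
by apply: comor_box (comor_tassoc _ _ _) (comor_idf _).
Qed.

Lemma Phi_pentagon x : Phi r s (tco t q) (Phi (tco r s) t q x) =
  tmap idfun (Phi s t q) (Phi r (tco s t) q (tmap (Phi r s t) idfun x)).
Proof.
have RC : coassoc R4 d4 by apply: box_coassoc (box3_coassoc rC sC tC) qC.1.
(* Tensoring an action of [omegaf] with an identity gives the action of a functional on four
   factors, because [eps] acts as the identity. *)
have A3 y : tmap (act omegaf (box (box r s) t)) (@idfun X) y =
    act (etens omegaf eps) R4 y.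
  by rewrite act_etens; apply: eq_tmap => // w; rewrite /= [RHS](qC.2 w).
have A1 y : tmap (@idfun U) (act omegaf (box (box s t) q)) y =
    act (etens eps omegaf) (box r (box (box s t) q)) y.
  by rewrite act_etens; apply: eq_tmap => // w; rewrite /= [RHS](rC.2 w).
have B3 : tmap (Phi r s t) (@idfun X) x =
    tmap (@tassoc k U V W) (@idfun X) (act (etens omegaf eps) R4 x).
  by rewrite -A3 tmap_comp; apply: eq_tmap.
have B1 y : tmap (@idfun U) (Phi s t q) y = tmap (@idfun U) (@tassoc k V W X)
    (act (etens eps omegaf) (box r (box (box s t) q)) y).
  by rewrite -A1 tmap_comp; apply: eq_tmap.
(* All actions are pulled back to [R4], where they compose by convolution, and the plain
   rebracketings are matched by [tassoc_pentagon]. What remains is an equality of functionals. *)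
rewrite B3 B1 [Phi r _ q _]/= (act_comor _ _ comor_tco2m).
rewrite (act_comor _ _ comor_tassoc2) /=.
rewrite [act _ _ (act (etens omegaf eps) _ _)](act_act _ _ _ RC) (act_act _ _ _ RC).
rewrite (act_comor (f := idfun) _ _ comor_tco2l) /= -tassoc_pentagon.
rewrite (act_comor _ _ comor_tco2r) (act_act _ _ _ RC).
congr (tassoc (tassoc _)); apply: eq_act; apply: conv_cocycle.
Qed.

End Pentagon.

(** * Normalisation of omega *)

Section PureMaps.
Context (k : fieldType) (U V : lmodType k).

Definition lpure (u : U) (v : V) : U \ox V := u \ot v.
Definition rpure (v : V) (u : U) : U \ox V := u \ot v.

Lemma lpure_linear u : linear (lpure u).
Proof. by rewrite /lpure; multilinear. Qed.
Lemma rpure_linear v : linear (rpure v).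
Proof. by rewrite /rpure; multilinear. Qed.

HB.instance Definition _ u := GRing.isLinear.Build k _ _ _ (lpure u) (lpure_linear u).
HB.instance Definition _ v := GRing.isLinear.Build k _ _ _ (rpure v) (rpure_linear v).

End PureMaps.

Section Units.
Context (k : fieldType) (H : coquasi_bialgebra k).

Local Notation d := (comul H).
Local Notation eps := (eps (H := H)).
Local Notation omegaf := (omegaf (H := H)).
Local Notation omegaVf := (omegaVf (H := H)).
Local Notation one := (cqd_one H).

(** The functionals are made to act on [C] itself: [phi] acts idempotently, and injectively because
    [psi] acts as a left inverse, hence it acts trivially. Evaluating [e] then recovers [phi]. *)
Lemma conv_idem_unit (C : lmodType k) (r : {linear C -> C \ox C})
    (e phi psi : {linear C -> k^o}) :
  coassoc r r -> counital r e ->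
  (forall c, \swd_(c1, c2 <- r c) ((e c1 : k) *: c2) = c) ->
  conv r phi phi =1 phi -> conv r psi phi =1 e -> phi =1 e.
Proof.
move=> rr re el phi2 psiphi c.
have actK x : act psi r (act phi r x) = x.
  by rewrite (act_act _ _ _ rr) (eq_act _ psiphi) (act_counital _ re).
have act1 x : act phi r x = x.
  by rewrite -[LHS]actK (act_act phi phi _ rr) (eq_act _ phi2) actK.
rewrite -{2}[c]act1 /act tsum_lin -{1}[c]el tsum_lin; apply: eq_tsum => c1 c2.
by rewrite !linearZ /= /GRing.scale /= mulrC.
Qed.

Lemma box_counitl h g : \swd_(c1, c2 <- box d d (h \ot g))
  ((etens eps eps c1 : k) *: c2) = h \ot g.
Proof.
rewrite box_tsum; last by multilinear.
transitivity (\swd_(h1, h2 <- d h) ((eps h1 : k) *: (h2 \ot g))).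
  apply: eq_tsum => h1 h2.
  rewrite -[in RHS](comul_counitl g) (tsum_map (g := fun g => h2 \ot g)); last by multilinear.
  rewrite tsum_scaler; apply: eq_tsum => g1 g2.
  by rewrite etensE pureZr scalerA.
by rewrite (tsum_counitl (F := fun h => h \ot g)) //; multilinear.
Qed.

Lemma om_cocycle h g x y :
  \swd_(h1, h2 <- d h) \swd_(g1, g2 <- d g) \swd_(x1, x2 <- d x) \swd_(y1, y2 <- d y)
    ((om h1 g1 (hmul H (x1 \ot y1)) : k) *: om (hmul H (h2 \ot g2)) x2 y2) =
  \swd_(h1, h2 <- d h)
  \swd_(g1, g' <- d g) \swd_(g2, g3 <- d g')
  \swd_(x1, x' <- d x) \swd_(x2, x3 <- d x')
  \swd_(y1, y2 <- d y)
    ((om g1 x1 y1 : k) *: ((om h1 (hmul H (g2 \ot x2)) y2 : k) *: om h2 g3 x3)).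
Proof.
transitivity (\swd_(h1, h2 <- d h) \swd_(g1, g2 <- d g)
    \swd_(x1, x2 <- d x) \swd_(y1, y2 <- d y)
      (omega h1 g1 (x1 *h y1) * omega (h2 *h g2) x2 y2)) => //.
rewrite omega_cocycle; do 6!apply: eq_tsum => ? ?.
by rewrite scalerA.
Qed.

Lemma om_unit h g : om h one g = eps h * eps g :> k.
Proof. exact: (omega_unit h g). Qed.

Lemma tsum_one (Z : lmodType k) (F : H -> H -> Z) : bilin F ->
  tsum F (d one) = F one one.
Proof. by move=> FB; rewrite comul_one tsum_pure. Qed.

Lemma hmul1 h : hmul H (one \ot h) = h. Proof. exact: Hmul1. Qed.
Lemma hmulr1 h : hmul H (h \ot one) = h. Proof. exact: Hmulr1. Qed.
Lemma eps_one : eps one = 1 :> k. Proof. exact: (@counit_one k H). Qed.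
Lemma eps_mul h g : eps (hmul H (h \ot g)) = eps h * eps g :> k.
Proof. exact: (@counit_mul k H). Qed.

(** Since [one] is group-like, fixing the first argument to [one] respects convolution, so the
    restriction of [omegaVf] is still a left inverse of that of [omegaf]. *)
Lemma om_unitl g h : om one g h = eps g * eps h :> k.
Proof.
pose f : {linear H \ox H -> (H \ox H) \ox H} := @tassocV k H H H \o lpure one.
have fE x y : omegaf (f (x \ot y)) = om one x y by rewrite /= /lpure tassocVE.
suff: omegaf \o f =1 etens eps eps.
  by move=> /(_ (g \ot h)); rewrite etensE -fE.
apply: (conv_idem_unit (psi := omegaVf \o f) (r := box d d)).
- by apply: box_coassoc; apply: comul_coassoc.
- by apply: box_counital; apply: comul_counital.
- by move=> c; tens_ext c x y; apply: box_counitl.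
- move=> c; tens_ext c x y; rewrite /conv box_tsum; last by multilinear.
  rewrite [RHS](fE x y); transitivity (\swd_(x1, x2 <- d x) \swd_(y1, y2 <- d y)
    ((om one x1 y1 : k) *: om one x2 y2)).
    by do 2!apply: eq_tsum => ? ?; congr (_ *: _); apply: fE.
  (* With h = g = 1 every factor having [one] in the middle is trivial by [om_unit]; what is left is
     the restricted functional on the left and its convolution square on the right. *)
  have := om_cocycle one one x y.
  rewrite !tsum_one; [|rewrite /om; by multilinear..].
  under eq_tsum => x1 x2.
    under eq_tsum => y1 y2 do
      rewrite om_unit eps_one mul1r eps_mul hmul1 -scalerA.
    rewrite -tsum_scaler (tsum_counitl (F := om one x2)); last by rewrite /om; multilinear.
    over.
  rewrite (tsum_counitl (F := fun x => om one x y)); last by rewrite /om; multilinear.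
  move=> ->; apply: eq_tsum => x1 x'.
  rewrite -[LHS](tsum_counitr (F := fun x => \swd_(y1, y2 <- d y)
    ((om one x1 y1 : k) *: om one x y2))); last by rewrite /om; multilinear.
  apply: eq_tsum => x2 x3; rewrite tsum_scaler; apply: eq_tsum => y1 y2.
  by rewrite hmul1 om_unit eps_one mul1r /GRing.scale /= mulrA mulrC.
- move=> c; tens_ext c x y; rewrite /conv box_tsum; last by multilinear.
  rewrite [RHS](etensE eps eps x y).
  have : \swd_(h1, h2 <- d one) \swd_(g1, g2 <- d x) \swd_(x1, x2 <- d y)
     ((omV h1 g1 x1 : k) *: om h2 g2 x2) = eps one * eps x * eps y.
    exact: (omegaVK one x y).
  rewrite tsum_one; last by rewrite /om /omV; multilinear.
  rewrite eps_one mul1r => <-.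
  by do 2!apply: eq_tsum => ? ?; rewrite /= /lpure !tassocVE.
Qed.

Lemma om_unitr g h : om g h one = eps g * eps h :> k.
Proof.
pose f : {linear H \ox H -> (H \ox H) \ox H} := rpure one.
have fE x y : omegaf (f (x \ot y)) = om x y one by [].
suff: omegaf \o f =1 etens eps eps.
  by move=> /(_ (g \ot h)); rewrite etensE -fE.
apply: (conv_idem_unit (psi := omegaVf \o f) (r := box d d)).
- by apply: box_coassoc; apply: comul_coassoc.
- by apply: box_counital; apply: comul_counital.
- by move=> c; tens_ext c x y; apply: box_counitl.
- move=> c; tens_ext c x y; rewrite /conv box_tsum; last by multilinear.
  rewrite [RHS](fE x y); transitivity (\swd_(x1, x2 <- d x) \swd_(y1, y2 <- d y)
    ((om x1 y1 one : k) *: om x2 y2 one)); first by [].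
  (* The inserted factor [om y1 one one] is trivial by [om_unit]; with it the convolution square
     becomes the right-hand side of the cocycle condition whose last two arguments are [one]. *)
  transitivity (\swd_(x1, x2 <- d x) \swd_(y1, y' <- d y) \swd_(y2, y3 <- d y')
    ((om y1 one one : k) *: ((om x1 (hmul H (y2 \ot one)) one : k) *: om x2 y3 one))).
    apply: eq_tsum => x1 x2.
    rewrite -(tsum_counitl (F := fun y => \swd_(y1, y2 <- d y)
      ((om x1 y1 one : k) *: om x2 y2 one))); last by rewrite /om; multilinear.
    apply: eq_tsum => y1 y'; rewrite tsum_scaler; apply: eq_tsum => y2 y3.
    by rewrite hmulr1 om_unit eps_one mulr1.
  (* The left-hand side of the same instance; its second factor is trivial by [om_unit]. *)
  transitivity (\swd_(x1, x2 <- d x) \swd_(y1, y2 <- d y)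
      ((om x1 y1 (hmul H (one \ot one)) : k) *: om (hmul H (x2 \ot y2)) one one)).
    transitivity (\swd_(x1, x2 <- d x) \swd_(y1, y2 <- d y)
      \swd_(z1, z2 <- d one) \swd_(w1, w2 <- d one)
      ((om x1 y1 (hmul H (z1 \ot w1)) : k) *: om (hmul H (x2 \ot y2)) z2 w2)).
      rewrite om_cocycle; do 3!apply: eq_tsum => ? ?.
      by rewrite !tsum_one // /om; multilinear.
    by do 2!apply: eq_tsum => ? ?; rewrite !tsum_one // /om; multilinear.
  rewrite -[RHS](tsum_counitr (F := fun x => om x y one)); last by rewrite /om; multilinear.
  apply: eq_tsum => x1 x2; rewrite -(tsum_counitr (F := fun y => om x1 y one));
    last by rewrite /om; multilinear.
  rewrite tsum_scaler; apply: eq_tsum => y1 y2.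
  rewrite hmul1 om_unit eps_mul eps_one mulr1 /GRing.scale /=.
  by rewrite mulrC mulrA.
- move=> c; tens_ext c x y; rewrite /conv box_tsum; last by multilinear.
  rewrite [RHS](etensE eps eps x y).
  have : \swd_(h1, h2 <- d x) \swd_(g1, g2 <- d y) \swd_(x1, x2 <- d one)
     ((omV h1 g1 x1 : k) *: om h2 g2 x2) = eps x * eps y * eps one.
    exact: (omegaVK x y one).
  rewrite eps_one mulr1 => <-.
  do 2!apply: eq_tsum => ? ?; rewrite tsum_one //.
  by rewrite /om /omV; multilinear.
Qed.

End Units.

(** * The bimodule A (x) A *)

Section PhiCoinvariants.
Context (k : fieldType) (H : coquasi_bialgebra k) (U V W : lmodType k).
Context (r : {linear U -> U \ox H}) (s : {linear V -> V \ox H})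
  (t : {linear W -> W \ox H}).
Hypotheses (rC : coaction r) (sC : coaction s) (tC : coaction t).
Implicit Types (u : U) (v : V) (w : W).

Lemma PhiE u v w : Phi r s t ((u \ot v) \ot w) =
  \swd_(u0, u1 <- r u) \swd_(v0, v1 <- s v) \swd_(w0, w1 <- t w)
    ((om u1 v1 w1 : k) *: (u0 \ot (v0 \ot w0))).
Proof.
rewrite /= [act _ _ _]/act (tsum_lin (@tassoc k U V W)) box_tsum; last by multilinear.
rewrite box_tsum; last by multilinear.
by do 3!apply: eq_tsum => ? ?; rewrite linearZ /= tassocE.
Qed.

(** A coinvariant factor puts the unit of [H] into one argument of omega, which then splits into
    counits absorbed by the two other coactions. The same argument serves the middle and the last
    position below. *)
Lemma Phi_coinvl u v w : r u = u \ot cqd_one H ->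
  Phi r s t ((u \ot v) \ot w) = u \ot (v \ot w).
Proof.
move=> ru; rewrite PhiE ru tsum_pure; last by rewrite /om; multilinear.
rewrite -{2}[v](sC.2 v) (tsum_map (g := fun v => u \ot (v \ot w))); last by multilinear.
apply: eq_tsum => v0 v1; rewrite -{2}[w](tC.2 w).
rewrite (tsum_map (g := fun w => u \ot (_ \ot w))); last by multilinear.
apply: eq_tsum => w0 w1.
by rewrite om_unitl pureZl !pureZr scalerA.
Qed.

Lemma Phi_coinvm u v w : s v = v \ot cqd_one H ->
  Phi r s t ((u \ot v) \ot w) = u \ot (v \ot w).
Proof.
move=> sv; rewrite PhiE sv -{2}[u](rC.2 u).
rewrite (tsum_map (g := fun u => u \ot (v \ot w))); last by multilinear.
apply: eq_tsum => u0 u1; rewrite tsum_pure; last by rewrite /om; multilinear.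
rewrite -{2}[w](tC.2 w).
rewrite (tsum_map (g := fun w => _ \ot (v \ot w))); last by multilinear.
apply: eq_tsum => w0 w1.
by rewrite om_unit pureZl !pureZr scalerA.
Qed.

Lemma Phi_coinvr u v w : t w = w \ot cqd_one H ->
  Phi r s t ((u \ot v) \ot w) = u \ot (v \ot w).
Proof.
move=> tw; rewrite PhiE tw -{2}[u](rC.2 u).
rewrite (tsum_map (g := fun u => u \ot (v \ot w))); last by multilinear.
apply: eq_tsum => u0 u1; rewrite -{2}[v](sC.2 v).
rewrite (tsum_map (g := fun v => _ \ot (v \ot w))); last by multilinear.
apply: eq_tsum => v0 v1; rewrite tsum_pure; last by rewrite /om; multilinear.
by rewrite om_unitr !pureZl !pureZr scalerA.
Qed.

Lemma PhiVE u v w : PhiV r s t (u \ot (v \ot w)) =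
  \swd_(u0, u1 <- r u) \swd_(v0, v1 <- s v) \swd_(w0, w1 <- t w)
    ((omV u1 v1 w1 : k) *: ((u0 \ot v0) \ot w0)).
Proof.
rewrite /= tassocVE [LHS]/act box_tsum; last by multilinear.
by rewrite box_tsum //; multilinear.
Qed.

End PhiCoinvariants.

Lemma colin_inv (k : fieldType) (H : coquasi_bialgebra k) (U V : lmodType k)
    (f : {linear U -> V}) (g : {linear V -> U}) (r : {linear U -> U \ox H}) s :
  colin f r s -> cancel f g -> cancel g f -> colin g s r.
Proof.
move=> c fg gf v; rewrite -{2}[v]gf (colin_tsum _ c); last by multilinear.
by rewrite [LHS]tens_sum; apply: eq_tsum => u0 u1; rewrite fg.
Qed.

(** * The left and right actions of A on A (x) A *)

Section Bimodule.
Context (k : fieldType) (H : coquasi_bialgebra k) (A : comodule_algebra H).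

Local Notation rA := (coact A).
Local Notation rAA := (tco rA rA).
Local Notation am := (ca_mul A).
Local Notation AA := (A \ox A).
Local Notation oneA := (ca_one A).

Lemma coact_coaction : coaction rA.
Proof. by split; [apply: coactA | apply: coact_counit]. Qed.

Let rAC := coact_coaction.
Let rAAC : coaction rAA := tco_coaction rAC rAC.

Lemma ca_mul_colin : colin am rAA rA.
Proof.
move=> x; tens_ext x a b; rewrite push_tsum; last by multilinear.
rewrite box_tsum; last by multilinear.
exact: coact_mul.
Qed.

(** Quasi-associativity of [A] is associativity in the monoidal category of comodules. *)
Lemma ca_mul_Phi x : am (tmap am idfun x) = am (tmap idfun am (Phi rA rA rA x)).
Proof.
pose g : {linear A \ox AA -> A} := am \o tmap idfun am.
change (am (tmap am idfun x) = g (Phi rA rA rA x)).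
tens_ext x y c; tens_ext y a b; rewrite PhiE tmapE ca_mul_quasiA !tsum_lin.
apply: eq_tsum => a0 a1; rewrite tsum_lin; apply: eq_tsum => b0 b1.
rewrite tsum_lin; apply: eq_tsum => c0 c1.
by rewrite linearZ /= tmapE.
Qed.

Definition ract : {linear AA \ox A -> AA} := tmap idfun am \o Phi rA rA rA.
Definition lact : {linear A \ox AA -> AA} := tmap am idfun \o PhiV rA rA rA.

(** Since [Phi] is bijective, arguments of [lact] can be written as values of [Phi]; with this lemma
    the inverse associator then disappears from the computation. *)
Lemma lact_Phi x : lact (Phi rA rA rA x) = tmap am idfun x.
Proof.
rewrite -[LHS]/(tmap am idfun (PhiV rA rA rA (Phi rA rA rA x))).
by rewrite PhiK.
Qed.

Lemma ract_colin : colin ract (tco rAA rA) rAA.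
Proof.
apply: colin_comp (Phi_colin rAC rAC rAC) _.
exact: colin_tmap (colin_id _) ca_mul_colin.
Qed.

Lemma lact_colin : colin lact (tco rA rAA) rAA.
Proof.
apply: (colin_comp (s := tco rAA rA)).
  exact: colin_inv (Phi_colin rAC rAC rAC) (PhiK rAC rAC rAC) (PhiVK rAC rAC rAC).
exact: colin_tmap ca_mul_colin (colin_id _).
Qed.

(** The left module axiom. Once [y] is a value of [Phi], naturality and the pentagon reduce it to
    the associativity [ca_mul_Phi]. *)
Lemma lactA y : lact (tmap am idfun y) = lact (tmap idfun lact (Phi rA rA rAA y)).
Proof.
rewrite -[y](PhiVK rAAC rAC rAC); move: (PhiV _ _ _ y) => {}y.
have N : tmap am idfun (Phi rAA rA rA y) =
    Phi rA rA rA (tmap (tmap am idfun) idfun y).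
  rewrite (Phi_nat (r := rAA) (s := rA) (t := rA) _ ca_mul_colin (colin_id _) (colin_id _)).
  by apply: eq_tmap => // z; rewrite /= tmap_id.
rewrite N lact_Phi (Phi_pentagon rAC rAC rAC rAC).
set w := tmap (Phi rA rA rA) idfun y.
have -> : tmap idfun lact (tmap idfun (Phi rA rA rA) (Phi rA rAA rA w)) =
    Phi rA rA rA (tmap (tmap idfun am) idfun w).
  rewrite (Phi_nat (r := rA) (s := rAA) (t := rA) _ (colin_id _) ca_mul_colin (colin_id _)).
  by rewrite tmap_comp; apply: eq_tmap => // z; apply: lact_Phi.
rewrite lact_Phi /w !tmap_comp; apply: eq_tmap => // z.
exact: ca_mul_Phi.
Qed.

(** The two actions commute. Both sides multiply factors 1, 2 and 3, 4 of a fourfold tensor, so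
    naturality and the pentagon suffice. *)
Lemma ract_lact w : ract (tmap lact idfun w) =
  lact (tmap idfun ract (Phi rA rAA rA w)).
Proof.
have [w' ->] : exists w', w = tmap (Phi rA rA rA) idfun w'.
  exists (tmap (PhiV rA rA rA) idfun w); rewrite tmap_comp tmap_id // => z.
  exact: PhiVK.
have -> : tmap lact idfun (tmap (Phi rA rA rA) idfun w') =
    tmap (tmap am idfun) idfun w'.
  by rewrite tmap_comp; apply: eq_tmap => // z; apply: lact_Phi.
have -> : tmap idfun ract (Phi rA rAA rA (tmap (Phi rA rA rA) idfun w')) =
   Phi rA rA rA (tmap (tmap idfun idfun) am (Phi rAA rA rA w')).
  rewrite (Phi_nat (r := rA) (s := rA) (t := rAA) _ (colin_id _) (colin_id _) ca_mul_colin).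
  by rewrite (Phi_pentagon rAC rAC rAC rAC) tmap_comp; apply: eq_tmap.
rewrite lact_Phi -[LHS]/(tmap idfun am (Phi rA rA rA _)).
rewrite (Phi_nat (r := rAA) (s := rA) (t := rA) _ ca_mul_colin (colin_id _) (colin_id _)).
by rewrite !tmap_comp; apply: eq_tmap => z /=; rewrite tmap_id.
Qed.

(** The right module axiom, again by naturality, the pentagon and [ca_mul_Phi]. *)
Lemma ractA y : ract (tmap ract idfun y) = ract (tmap idfun am (Phi rAA rA rA y)).
Proof.
have -> : tmap ract idfun y =
    tmap (tmap idfun am) idfun (tmap (Phi rA rA rA) idfun y).
  by rewrite tmap_comp; apply: eq_tmap.
rewrite -[LHS]/(tmap idfun am (Phi rA rA rA _)).
rewrite (Phi_nat (r := rA) (s := rAA) (t := rA) _ (colin_id _) ca_mul_colin (colin_id _)).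
have -> : tmap idfun am (Phi rAA rA rA y) =
    tmap (tmap idfun idfun) am (Phi rAA rA rA y).
  by apply: eq_tmap => // z; rewrite /= tmap_id.
rewrite -[RHS]/(tmap idfun am (Phi rA rA rA _)).
rewrite (Phi_nat (r := rA) (s := rA) (t := rAA) _ (colin_id _) (colin_id _) ca_mul_colin).
rewrite (Phi_pentagon rAC rAC rAC rAC) !tmap_comp.
by apply: eq_tmap => // z; apply: ca_mul_Phi.
Qed.

(** * Bimodule endomorphisms given by coinvariants *)

Section Insertion.
Context (z : AA).

Definition rins : {linear A -> AA} := ract \o lpure z.
(* The bimodule endomorphism of A (x) A with 1 (x) 1 |-> z (for z coinvariant). *)
Definition ins : {linear AA -> AA} := lact \o tmap idfun rins.

Hypothesis zC : rAA z = z \ot cqd_one H.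

(** Coinvariance of [z] contributes only a factor 1 to the codiagonal coaction of z (x) b. All
    colinearity of [ins z] rests on this. *)
Lemma lpure_colin : colin (@lpure k AA A z) rA (tco rAA rA).
Proof.
move=> b; rewrite /lpure tcoE zC tsum_pure; last by multilinear.
by apply: eq_tsum => b0 b1; rewrite hmul1.
Qed.

Lemma rins_colin : colin rins rA rAA.
Proof. exact: colin_comp lpure_colin ract_colin. Qed.

Lemma ins_colin : colin ins rAA rAA.
Proof. exact: colin_comp (colin_tmap (colin_id _) rins_colin) lact_colin. Qed.

(** Left linearity: the action on the left factor is the module axiom [lactA], and the associator
    passes [rins z] by naturality because [rins z] is colinear. *)
Lemma ins_lact x : ins (lact x) = lact (tmap idfun ins x).
Proof.
rewrite -[x](PhiVK rAC rAC rAC); move: (PhiV _ _ _ x) => {}x.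
rewrite lact_Phi.
have -> : ins (tmap am idfun x) = lact (tmap am idfun (tmap idfun rins x)).
  rewrite -[LHS]/(lact (tmap idfun rins (tmap am idfun x))) !tmap_comp.
  by congr (lact _); apply: eq_tmap.
rewrite lactA; congr (lact _).
have -> : tmap idfun rins x = tmap (tmap idfun idfun) rins x.
  by apply: eq_tmap => // w; rewrite /= tmap_id.
rewrite (Phi_nat (r := rA) (s := rA) (t := rA) _ (colin_id _) (colin_id _) rins_colin).
by rewrite tmap_comp; apply: eq_tmap.
Qed.

(** By [ractA], z(ab) and (za)b differ by an associator whose first argument is the coinvariant [z],
    hence trivial. *)
Lemma rins_ca_mul x : rins (am x) = ract (tmap rins idfun x).
Proof.
have -> : tmap rins idfun x = tmap ract idfun (tmap (lpure z) idfun x).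
  by rewrite tmap_comp; apply: eq_tmap.
rewrite ractA; tens_ext x a b; rewrite tmapE Phi_coinvl // tmapE.
by [].
Qed.

Lemma ins_ract x : ins (ract x) = ract (tmap ins idfun x).
Proof.
have -> : tmap ins idfun x = tmap lact idfun (tmap (tmap idfun rins) idfun x).
  by rewrite tmap_comp; apply: eq_tmap.
rewrite ract_lact; congr (lact _).
rewrite (Phi_nat (r := rA) (s := rA) (t := rA) _ (colin_id _) rins_colin (colin_id _)).
rewrite /ract [LHS]/= !tmap_comp; apply: eq_tmap => // w.
exact: rins_ca_mul.
Qed.

(** An endomorphism commuting with both actions can be carried inside to the inserted element, here
    an arbitrary [y]. *)
Lemma ins_ins y x : ins (lact (tmap idfun (ract \o lpure y) x)) =
  lact (tmap idfun (ract \o lpure (ins y)) x).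
Proof.
rewrite ins_lact tmap_comp; congr (lact _); apply: eq_tmap => // b.
by rewrite [LHS]ins_ract tmapE.
Qed.

Lemma ins_coinv y : rAA y = y \ot cqd_one H -> rAA (ins y) = ins y \ot cqd_one H.
Proof. by move=> yC; rewrite ins_colin yC tsum_pure //; multilinear. Qed.

End Insertion.

(** [oneA] is the last argument of the associator in [ract] and the first one of that in [lact];
    both associators are therefore trivial. *)
Lemma ins_oner z : ins z (oneA \ot oneA) = z.
Proof.
rewrite -[LHS]/(lact (tmap idfun (rins z) (oneA \ot oneA))) tmapE.
have -> : rins z oneA = z.
  rewrite -[LHS]/(tmap idfun am (Phi rA rA rA (z \ot oneA))).
  by tens_ext z c d; rewrite Phi_coinvr ?coact_one // tmapE ca_mulr1.
tens_ext z c d; rewrite -(Phi_coinvl (r := rA) (s := rA) (t := rA)) ?coact_one //.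
by rewrite lact_Phi tmapE ca_mul1.
Qed.

Lemma ins_onel x : ins (oneA \ot oneA) x = x.
Proof.
tens_ext x a b.
rewrite -[LHS]/(lact (tmap idfun (rins (oneA \ot oneA)) (a \ot b))) tmapE.
have -> : rins (oneA \ot oneA) b = oneA \ot b.
  rewrite -[LHS]/(tmap idfun am (Phi rA rA rA ((oneA \ot oneA) \ot b))).
  by rewrite Phi_coinvl ?coact_one // tmapE ca_mul1.
rewrite -(Phi_coinvm (r := rA) (s := rA) (t := rA)) ?coact_one //.
by rewrite lact_Phi tmapE ca_mulr1.
Qed.

(** The product of two values of omega is turned into an iterated scaling, the shape that
    [multilinear] handles. *)
Lemma mulAAE (x y : AA) : mulAA x y =
  \swd_(a, b <- x) \swd_(c, d <- y)
  \swd_(a0, a1 <- coact A a)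
  \swd_(b0, b' <- coact A b) \swd_(b1, b2 <- comul H b')
  \swd_(c0, c' <- coact A c) \swd_(c1, c2 <- comul H c')
  \swd_(d0, d' <- coact A d) \swd_(d1, d2 <- comul H d')
    ((omV a1 c1 (hmul H (d1 \ot b1)) : k) *: ((om c2 d2 b2 : k) *:
      (am (a0 \ot c0) \ot am (d0 \ot b0)))).
Proof. by do 9!apply: eq_tsum => ? ?; rewrite scalerA. Qed.

Lemma lactE a c e : lact (a \ot (c \ot e)) =
  \swd_(a0, a1 <- rA a) \swd_(c0, c1 <- rA c) \swd_(e0, e1 <- rA e)
    ((omV a1 c1 e1 : k) *: (am (a0 \ot c0) \ot e0)).
Proof.
rewrite -[LHS]/(tmap am idfun (PhiV rA rA rA (a \ot (c \ot e)))) PhiVE.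
rewrite tsum_lin; apply: eq_tsum => a0 a1; rewrite tsum_lin; apply: eq_tsum => c0 c1.
by rewrite tsum_lin; apply: eq_tsum => e0 e1; rewrite linearZ /= tmapE.
Qed.

Lemma ractE c d b : ract ((c \ot d) \ot b) =
  \swd_(c0, c1 <- rA c) \swd_(d0, d1 <- rA d) \swd_(b0, b1 <- rA b)
    ((om c1 d1 b1 : k) *: (c0 \ot am (d0 \ot b0))).
Proof.
rewrite -[LHS]/(tmap idfun am (Phi rA rA rA ((c \ot d) \ot b))) PhiE.
rewrite tsum_lin; apply: eq_tsum => c0 c1; rewrite tsum_lin; apply: eq_tsum => d0 d1.
by rewrite tsum_lin; apply: eq_tsum => b0 b1; rewrite linearZ /= tmapE.
Qed.

(** The right action of [b] on c (x) d yields omega(c2, d2, b2); the left action of [a] on the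
    result yields the inverse of omega at a1, c1, d1 b1. The rest is coassociativity and
    reordering. *)
Lemma mulAA_ins x y : mulAA x y = ins y x.
Proof.
rewrite -[RHS]/(lact (tmap idfun (ract \o lpure y) x)) mulAAE /om /omV.
tens_ext x a b.
have -> : lact (tmap idfun (ract \o lpure y) (a \ot b)) = lact (a \ot ract (y \ot b)).
  by rewrite tmapE.
rewrite tsum_pure; last by multilinear.
tens_ext y c d.
rewrite tsum_pure; last by multilinear.
(* The coproducts of [b'], [c'], [d'] become iterated coactions, the form in which the two actions
   produce these legs. *)
transitivity (\swd_(a0, a1 <- rA a)
    \swd_(b0, b2 <- rA b) \swd_(b00, b1 <- rA b0)
    \swd_(c0, c2 <- rA c) \swd_(c00, c1 <- rA c0)
    \swd_(d0, d2 <- rA d) \swd_(d00, d1 <- rA d0)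
    ((omV a1 c1 (hmul H (d1 \ot b1)) : k) *: ((om c2 d2 b2 : k) *:
      (am (a0 \ot c00) \ot am (d00 \ot b00))))).
  apply: eq_tsum => a0 a1.
  rewrite -(coassoc_tsum (F := fun b0 b1 b2 =>
    \swd_(c0, c' <- rA c) \swd_(c1, c2 <- comul H c')
    \swd_(d0, d' <- rA d) \swd_(d1, d2 <- comul H d')
    ((omV a1 c1 (hmul H (d1 \ot b1)) : k) *: ((om c2 d2 b2 : k) *:
      (am (a0 \ot c0) \ot am (d0 \ot b0))))) _ rAC.1);
    [|rewrite /om /omV; by multilinear..].
  apply: eq_tsum => b0 b2; apply: eq_tsum => b00 b1.
  rewrite -(coassoc_tsum (F := fun c0 c1 c2 =>
    \swd_(d0, d' <- rA d) \swd_(d1, d2 <- comul H d')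
    ((omV a1 c1 (hmul H (d1 \ot b1)) : k) *: ((om c2 d2 b2 : k) *:
      (am (a0 \ot c0) \ot am (d0 \ot b00))))) _ rAC.1);
    [|rewrite /om /omV; by multilinear..].
  apply: eq_tsum => c0 c2; apply: eq_tsum => c00 c1.
  by rewrite -(coassoc_tsum (F := fun d0 d1 d2 =>
    ((omV a1 c1 (hmul H (d1 \ot b1)) : k) *: ((om c2 d2 b2 : k) *:
      (am (a0 \ot c00) \ot am (d0 \ot b00))))) _ rAC.1);
    [|rewrite /om /omV; by multilinear..].
pose g : {linear AA -> AA} := lact \o lpure a.
rewrite -[RHS]/(g (ract ((c \ot d) \ot b))) ractE.
transitivity (
    \swd_(c0, c2 <- rA c) \swd_(d0, d2 <- rA d) \swd_(b0, b2 <- rA b)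
    \swd_(a0, a1 <- rA a)
    \swd_(c00, c1 <- rA c0) \swd_(d00, d1 <- rA d0) \swd_(b00, b1 <- rA b0)
    ((omV a1 c1 (hmul H (d1 \ot b1)) : k) *: ((om c2 d2 b2 : k) *:
      (am (a0 \ot c00) \ot am (d00 \ot b00))))); last first.
  do 3!(rewrite tsum_lin; apply: eq_tsum => ? ?).
  rewrite linearZ_LR -[g _]/(lact (a \ot _)) lactE.
  do 2!(rewrite tsum_scaler; apply: eq_tsum => ? ?).
  (* The last factor fed to [lact] is the product of [d0] and [b0]; its coaction supplies the
     argument d1 b1. *)
  rewrite (colin_tsum _ ca_mul_colin); last by rewrite /omV; multilinear.
  rewrite push_tsum; last by rewrite /omV; multilinear.
  rewrite box_tsum; last by rewrite /omV; multilinear.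
  do 2!(rewrite tsum_scaler; apply: eq_tsum => ? ?).
  by rewrite !scalerA mulrC.
under [RHS]eq_tsum => ? ? do under eq_tsum => ? ? do rewrite tsumC.
under [RHS]eq_tsum => ? ? do rewrite tsumC.
rewrite [RHS]tsumC; apply: eq_tsum => a0 a1.
under [RHS]eq_tsum => ? ? do rewrite tsumC.
rewrite [RHS]tsumC; apply: eq_tsum => b0 b2.
under [RHS]eq_tsum => ? ? do under eq_tsum => ? ? do under eq_tsum => ? ? do rewrite tsumC.
under [RHS]eq_tsum => ? ? do under eq_tsum => ? ? do rewrite tsumC.
under [RHS]eq_tsum => ? ? do rewrite tsumC.
rewrite [RHS]tsumC; apply: eq_tsum => b00 b1.
by apply: eq_tsum => c0 c2; rewrite tsumC.
Qed.

End Bimodule.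

(** * The algebra of coinvariants *)

Section CoinvariantTensors.
Context (k : fieldType) (H : coquasi_bialgebra k) (A : comodule_algebra H).

Local Notation rA := (coact A).
Local Notation rAA := (tco rA rA).
Local Notation oneA := (ca_one A).
Local Notation L := (coinvL A).
Local Notation B := (coinvB A).

Lemma mulAA_bilin : bilin (@mulAA k H A).
Proof.
have [F [EF FB]] : exists F, @mulAA k H A =2 F /\ bilin F.
  (* The witness, found by unification, is the right-hand side of [mulAAE]. *)
  by eexists; split; [exact: mulAAE | rewrite /om /omV; multilinear].
by split=> [x|y] a u v; rewrite !EF; [apply: FB.1 | apply: FB.2].
Qed.

Lemma codiag_tco x : codiag A A x = rAA x.
Proof. by tens_ext x a b; rewrite tcoE /codiag /Hmul tsum_pure //; multilinear. Qed.

Lemma coinvL_tco (x : L) : rAA (val x) = val x \ot cqd_one H.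
Proof. by rewrite -codiag_tco; apply: (coinvP x). Qed.

Lemma mulAA_coinv (x y : L) : mulAA (val x) (val y) \in coinvariant (codiag A A).
Proof.
rewrite inE /= codiag_tco mulAA_ins; apply/eqP.
by apply: ins_coinv; apply: coinvL_tco.
Qed.

Definition mulL (x y : L) : L := Coinv (mulAA_coinv x y).

Lemma oneL_coinv : oneA \ot oneA \in coinvariant (codiag A A).
Proof.
rewrite inE /= codiag_tco tcoE !coact_one tsum_pure; last by multilinear.
by rewrite tsum_pure; [rewrite hmul1 | multilinear].
Qed.

Definition oneL : L := Coinv oneL_coinv.

Lemma mulL_bilin : bilin mulL.
Proof.
have [Mr Ml] := mulAA_bilin.
split=> [x|y] a u v; apply: val_inj; rewrite linearP /=; [exact: Mr | exact: Ml].
Qed.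

Lemma coinvL_algebra : assoc_algebra mulL oneL.
Proof.
split=> [|x y z|x|x]; first exact: mulL_bilin.
- apply: val_inj => /=; rewrite !mulAA_ins.
  have E := ins_ins (coinvL_tco z).
  by rewrite -[RHS]/(ins (val z) (ins (val y) (val x))) [RHS]E.
(* The product of x and y is [ins y x], so the left unit law is evaluation of [ins] at 1 (x) 1, and
   the right one says that inserting 1 (x) 1 is the identity. *)
- by apply: val_inj => /=; rewrite mulAA_ins ins_oner.
- by apply: val_inj => /=; rewrite mulAA_ins ins_onel.
Qed.

Definition coinvB_incl (b : B) : A := val b.

Lemma coinvB_incl_linear : linear coinvB_incl.
Proof. by move=> a x y; rewrite /coinvB_incl linearP. Qed.

HB.instance Definition _ := GRing.isLinear.Build k _ _ _ coinvB_incl coinvB_incl_linear.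

Lemma tmap_incl_coinv x : tmap coinvB_incl coinvB_incl x \in coinvariant (codiag A A).
Proof.
rewrite inE /= codiag_tco; apply/eqP; tens_ext x b b'.
rewrite tmapE tcoE !coinvP tsum_pure; last by multilinear.
by rewrite tsum_pure; [rewrite hmul1 | multilinear].
Qed.

Definition tensB_incl (x : B \ox B) : L := Coinv (tmap_incl_coinv x).

Lemma tensB_incl_linear : linear tensB_incl.
Proof. by move=> a x y; apply: val_inj; rewrite /= !linearP. Qed.

(** In each of the two actions the first argument of the associator is coinvariant, so both values
    of omega are trivial. *)
Lemma mulAA_coinvB (b b' c c' : B) :
  mulAA (val b \ot val b') (val c \ot val c') =
  (val b *a val c) \ot (val c' *a val b').
Proof.
rewrite mulAA_ins.
rewrite -[LHS]/(lact A (tmap idfun (rins (val c \ot val c')) (val b \ot val b'))) tmapE.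
have -> : rins (val c \ot val c') (val b') = val c \ot (val c' *a val b').
  rewrite -[LHS]/(tmap idfun (ca_mul A) (Phi rA rA rA ((val c \ot val c') \ot val b'))).
  by rewrite (Phi_coinvl (coact_coaction A) (coact_coaction A)) ?coinvP // tmapE.
rewrite -(Phi_coinvl (r := rA) (coact_coaction A) (coact_coaction A)) ?coinvP //.
by rewrite lact_Phi tmapE.
Qed.

Lemma tensB_incl_mul :
  {morph tensB_incl : x y / tens_op_mul mulB mulB x y >-> mulL x y}.
Proof.
have [mB _ _ _] := coinvB_algebra A.
have [Tr Tl] := tens_op_mul_bilin mB mB.
have [Mr Ml] := mulAA_bilin.
move=> x y; apply: val_inj => /=; tens_ext x b b'; tens_ext y c c'.
by rewrite tens_op_mul_pure // !tmapE mulAA_coinvB.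
Qed.

Lemma tensB_pureE (b b' : B) :
  b \ot b' = tens_op_mul mulB mulB (b \ot oneB A) (oneB A \ot b').
Proof.
have [mB _ l1 r1] := coinvB_algebra A.
by rewrite tens_op_mul_pure // r1 r1.
Qed.

End CoinvariantTensors.

Theorem proposition34 (k : fieldType) (H : coquasi_bialgebra k)
    (A : comodule_algebra H) :
  exists (mulL : coinvL A -> coinvL A -> coinvL A) (oneL : coinvL A),
    [/\ forall x y : coinvL A, val (mulL x y) = mulAA (val x) (val y),
        val oneL = ca_one A \ot ca_one A,
        assoc_algebra mulL oneL
      & exists phi : coinvB A \ox coinvB A -> coinvL A,
          [/\ algebra_map (tens_op_mul mulB mulB)
                (oneB A \ot oneB A) mulL oneL phi,
              forall b : coinvB A, val (phi (b \ot oneB A)) = val b \ot ca_one A,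
              forall b : coinvB A, val (phi (oneB A \ot b)) = ca_one A \ot val b
            & forall psi : coinvB A \ox coinvB A -> coinvL A,
                algebra_map (tens_op_mul mulB mulB)
                  (oneB A \ot oneB A) mulL oneL psi ->
                (forall b : coinvB A,
                   val (psi (b \ot oneB A)) = val b \ot ca_one A) ->
                (forall b : coinvB A,
                   val (psi (oneB A \ot b)) = ca_one A \ot val b) ->
                psi =1 phi]].
Proof.
have inclE (b b' : coinvB A) : val (tensB_incl (b \ot b')) = val b \ot val b'.
  by rewrite /= tmapE.
exists (@mulL k H A), (oneL A); split=> //; first exact: coinvL_algebra.
exists (@tensB_incl k H A); split=> [|b|b|psi [psiL psiM _] psil psir].
- split; [exact: tensB_incl_linear | exact: tensB_incl_mul |].
  by apply: val_inj; rewrite inclE.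
- by rewrite inclE.
- by rewrite inclE.
apply: tens_lin_eq => // [|b b']; first exact: tensB_incl_linear.
(* A pure tensor is a product of elements from the two copies of B, where both maps are prescribed;
   multiplicativity forces them to agree. *)
rewrite tensB_pureE psiM tensB_incl_mul.
by congr (mulL _ _); apply: val_inj; rewrite ?psil ?psir inclE.
Qed.
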